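(* Let $c\in\mathbb{N}$, let $m:\widehat\Gamma\to\{0,1,\dots,c\}$ be Borel, and let $H$ be a filter relative to $m$ and $\alpha^*$. Let $\mathcal{K}$ be the Hilbert space $$\mathcal{K}=\bigoplus_{i=1}^cL^2(\sigma_i),$$ and define an operator $S_H$ on $\mathcal{K}$ by $$(S_Hf)(\omega)=H^t(\omega)f(\alpha^*(\omega)).$$ Then $S_H$ is an isometry on $\mathcal{K}$. If the filter $H$ is low-pass of some rank $a$ between $1$ and $c$, then $S_H$ is a pure isometry, that is, $\bigcap_{n=0}^\infty S_H^n\mathcal{K}=\{0\}$.
   Context: Standing assumptions: $\Gamma$ is a countable (discrete) abelian group with compact dual group $\widehat\Gamma$, whose identity is denoted $1$, equipped with normalised Haar measure $\lambda$. $\alpha$ is an injective endomorphism of $\Gamma$ such that $\alpha(\Gamma)$ has finite index $N$ in $\Gamma$. $\alpha^*$ is the surjective endomorphism of $\widehat\Gamma$ given by $\alpha^*(\omega)=\omega\circ\alpha$; one has $|\ker\alpha^*|=N$. It is assumed that $\bigcup_{n\ge1}\ker\alpha^{*n}$ is dense in $\widehat\Gamma$ (equivalently $\bigcap_{n\ge1}\alpha^n(\Gamma)=\{0\}$). For $1\le i\le c$ let $\sigma_i=\{\omega\in\widehat\Gamma:m(\omega)\ge i\}$; $L^2(\sigma_i)$ is taken with respect to $\lambda$. Elements of $\bigoplus_iL^2(\sigma_i)$ are viewed as ($\lambda$-a.e. classes of) functions $f:\widehat\Gamma\to\mathbb{C}^c$ whose $i$th coordinate vanishes outside $\sigma_i$.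 A filter relative to $m$ and $\alpha^*$ is a Borel function $H=[h_{i,j}]:\widehat\Gamma\to M_c(\mathbb{C})$ such that $h_{i,j}$ vanishes outside $\sigma_j$ and $$\sum_{\alpha^*(\zeta)=\omega}H(\zeta)H^*(\zeta)=N\Sigma(\omega)\quad\text{for almost all }\omega\in\widehat\Gamma,$$ where $\Sigma(\omega)$ is the diagonal matrix with diagonal entries $\chi_{\sigma_i}(\omega)$. $H^t$ denotes the transpose and $H^*$ the conjugate transpose. The filter is low-pass of rank $a$ if $H$ is continuous near $1$ (i.e. on a neighborhood of $1$) and $H(1)$ has the block form $$H(1)=\begin{pmatrix}N^{1/2}1_a&0\\0&0\end{pmatrix},$$ where $1_a$ is the $a\times a$ identity matrix.
   Formalization: The purity assertion is proved under the added assumption N > 1; for N = 1 density forces Γ = {0}, and then a low-pass filter gives S_H equal to the identity on a nonzero space, which is not pure. *)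

(* Defs.v *)
From HB Require Import structures.
From mathcomp Require Import all_boot all_order all_algebra.
From mathcomp Require Import generic_quotient ring_quotient complex.
From mathcomp Require Import all_classical all_reals all_analysis.
From mathcomp Require Import measurable_realfun ring.

Set Implicit Arguments.
Unset Strict Implicit.
Unset Printing Implicit Defensive.

Import Order.TTheory GRing.Theory Num.Theory.
Import numFieldNormedType.Exports.

Local Open Scope classical_set_scope.
Local Open Scope ring_scope.
Local Open Scope quotient_scope.

HB.instance Definition _ (R : realType) := PseudoPointedMetric.copy R[i] (R[i])^o.

Record dualGroup (R : realType) (G : zmodType) := Dual {
  dual_fun :> G -> R[i] ;
  dual_norm1 : forall x, `|dual_fun x| = 1 ;
  dualD : forall x y, dual_fun (x + y) = dual_fun x * dual_fun y }.

Section dual_group.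
Variables (R : realType) (G : zmodType).
Local Notation dual := (dualGroup R G).

Lemma dualP (f g : dual) : f =1 g -> f = g.
Proof.
case: f g => [f f1 fD] [g g1 gD] /= /funext fg; subst g.
by congr Dual; exact: Prop_irrelevance.
Qed.

HB.instance Definition _ := gen_eqMixin dual.
HB.instance Definition _ := gen_choiceMixin dual.

Definition dual_one : dual.
Proof.
apply: (@Dual R G (fun=> 1)) => [x|x y]; first by rewrite normr1.
by rewrite mulr1.
Defined.

Definition dual_inv (f : dual) : dual.
Proof.
apply: (@Dual R G (fun x => (f x)^-1)) => [x|x y].
  by rewrite normfV dual_norm1 invr1.
by rewrite dualD invfM.
Defined.

Definition dual_mul (f g : dual) : dual.
Proof.
apply: (@Dual R G (fun x => f x * g x)) => [x|x y].
  by rewrite normrM !dual_norm1 mulr1.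
by rewrite !dualD mulrACA.
Defined.

Lemma dual_neq0 (f : dual) x : f x != 0.
Proof. by rewrite -normr_eq0 dual_norm1 oner_eq0. Qed.

Let dual_mulA : associative dual_mul.
Proof. by move=> f g h; apply: dualP => x /=; rewrite mulrA. Qed.
Let dual_mul1 : left_id dual_one dual_mul.
Proof. by move=> f; apply: dualP => x /=; rewrite mul1r. Qed.
Let dual_mul1r : right_id dual_one dual_mul.
Proof. by move=> f; apply: dualP => x /=; rewrite mulr1. Qed.
Let dual_mulV : left_inverse dual_one dual_inv dual_mul.
Proof. by move=> f; apply: dualP => x /=; rewrite mulVf ?dual_neq0. Qed.
Let dual_mulVr : right_inverse dual_one dual_inv dual_mul.
Proof. by move=> f; apply: dualP => x /=; rewrite mulfV ?dual_neq0. Qed.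

HB.instance Definition _ := isGroup.Build dual
  dual_mulA dual_mul1 dual_mul1r dual_mulV dual_mulVr.

HB.instance Definition _ := isPointed.Build dual dual_one.

(* The compact-open topology, which for discrete [G] is that of pointwise
   convergence *)
HB.instance Definition _ := Topological.copy dual
  (initial_topology (@dual_fun R G : dual -> {ptws G -> R[i]})).

HB.instance Definition _ := Measurable.copy dual
  (g_sigma_algebraType (@open dual)).

End dual_group.

Definition dual_endo (R : realType) (G : zmodType) (alpha : {additive G -> G})
  (w : dualGroup R G) : dualGroup R G.
Proof.
apply: (@Dual R G (w \o alpha)) => [x|x y] /=; first exact: dual_norm1.
by rewrite raddfD dualD.
Defined.

(* Among probability measures this characterises the normalised Haar measure;
   regularity is automatic, the dual of a countable group being compact and
   metrisable. *)
Definition translation_invariant (R : realType) (G : zmodType)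
    (lambda : set (dualGroup R G) -> \bar R) : Prop :=
  forall (w : dualGroup R G) (A : set (dualGroup R G)), measurable A ->
    lambda [set (w * x)%g | x in A] = lambda A.

Definition image_cosets (G : zmodType) (alpha : G -> G) : set (set G) :=
  [set [set x + alpha y | y in [set: G]] | x in [set: G]].

(* Borel measurability, identifying p x q complex matrices with R^(2pq) *)
Definition measurable_mx d (T : measurableType d) (R : realType) p q
    (A : T -> 'M[R[i]]_(p, q)) : Prop :=
  forall i j, measurable_fun setT (fun x => complex.Re (A x i j)) /\
              measurable_fun setT (fun x => complex.Im (A x i j)).

Definition sqnorm (R : realType) c (v : 'cV[R[i]]_c) : R :=
  \sum_(i < c) (complex.Re (v i 0) ^+ 2 + complex.Im (v i 0) ^+ 2).

Section L2sum.
Context d (T : measurableType d) (R : realType) (mu : {measure set T -> \bar R}).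
Context (c : nat) (s : 'I_c -> set T).

(* Representatives of the elements of the direct sum of the L^2(s i) *)
Definition L2fun_pred : {pred T -> 'cV[R[i]]_c} :=
  mem [set f | [/\ measurable_mx f,
                   (\int[mu]_x (sqnorm (f x))%:E < +oo)%E &
                   forall i x, ~ s i x -> f x i 0 = 0]].

Record L2fun := L2Fun { L2fun_val :> T -> 'cV[R[i]]_c ; _ : L2fun_val \in L2fun_pred }.

HB.instance Definition _ := [isSub for L2fun_val].
HB.instance Definition _ := [Choice of L2fun by <:].

Lemma sqnorm_ge0 (v : 'cV[R[i]]_c) : 0 <= sqnorm v.
Proof. by apply: sumr_ge0 => i _; rewrite addr_ge0 ?sqr_ge0. Qed.

Lemma measurable_sqnorm (f : T -> 'cV[R[i]]_c) : measurable_mx f ->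
  measurable_fun setT (fun x => sqnorm (f x)).
Proof.
move=> mf; apply: measurable_sum => i.
by have [? ?] := mf i 0; apply: measurable_funD; apply: measurable_funX.
Qed.

Lemma ReD (z w : R[i]) : complex.Re (z + w) = complex.Re z + complex.Re w.
Proof. by case: z w => ? ? []. Qed.

Lemma ImD (z w : R[i]) : complex.Im (z + w) = complex.Im z + complex.Im w.
Proof. by case: z w => ? ? []. Qed.

Lemma ReM (z w : R[i]) : complex.Re (z * w) =
  complex.Re z * complex.Re w - complex.Im z * complex.Im w.
Proof. by case: z w => ? ? []. Qed.

Lemma ImM (z w : R[i]) : complex.Im (z * w) =
  complex.Re z * complex.Im w + complex.Im z * complex.Re w.
Proof. by case: z w => ? ? []. Qed.

Lemma measurable_mxDZ (a : R[i]) (f g : T -> 'cV[R[i]]_c) :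
  measurable_mx f -> measurable_mx g -> measurable_mx (a *: f + g).
Proof.
move=> mf mg i j; have [fR fI] := mf i j; have [gR gI] := mg i j.
have E x : (a *: f + g) x i j = a * f x i j + g x i j by rewrite !mxE.
split.
- under eq_fun do rewrite E ReD ReM.
  apply: measurable_funD gR; apply: measurable_funB; exact: measurable_funM.
- under eq_fun do rewrite E ImD ImM.
  apply: measurable_funD gI; apply: measurable_funD; exact: measurable_funM.
Qed.

Lemma sqnormDZ (a : R[i]) (u v : 'cV[R[i]]_c) :
  sqnorm (a *: u + v) <=
    2 * (complex.Re a ^+ 2 + complex.Im a ^+ 2) * sqnorm u + 2 * sqnorm v.
Proof.
rewrite /sqnorm !mulr_sumr -big_split /=; apply: ler_sum => i _.
rewrite !mxE ReD ImD ReM ImM.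
move: (complex.Re a) (complex.Im a) (complex.Re (u i 0)) (complex.Im (u i 0)).
move: (complex.Re (v i 0)) (complex.Im (v i 0)) => p q r s0 t w.
rewrite -subr_ge0.
have -> : 2 * (r ^+ 2 + s0 ^+ 2) * (t ^+ 2 + w ^+ 2) + 2 * (p ^+ 2 + q ^+ 2) -
  ((r * t - s0 * w + p) ^+ 2 + (r * w + s0 * t + q) ^+ 2) =
  (r * t - s0 * w - p) ^+ 2 + (r * w + s0 * t - q) ^+ 2 by ring.
by rewrite addr_ge0 ?sqr_ge0.
Qed.

Lemma L2fun_submod_closed : submod_closed L2fun_pred.
Proof.
split=> [|a f g]; rewrite !inE.
  split=> [i j||i x _]; last by rewrite mxE.
    by under eq_fun do rewrite mxE; under [X in _ /\ measurable_fun _ X]eq_fun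
      do rewrite mxE; split; exact: measurable_cst.
  rewrite integral0_eq ?ltry// => x _; congr EFin.
  by rewrite /sqnorm big1 // => i _; rewrite mxE /= expr0n addr0.
move=> [mf fi f0] [mg gi g0]; split; first exact: measurable_mxDZ.
  set k : R := 2 * (complex.Re a ^+ 2 + complex.Im a ^+ 2).
  have k0 : 0 <= k by rewrite mulr_ge0 ?addr_ge0 ?sqr_ge0.
  have mF := measurable_sqnorm mf; have mG := measurable_sqnorm mg.
  have eF (u : 'cV[R[i]]_c) : (0 <= (sqnorm u)%:E)%E by rewrite lee_fin sqnorm_ge0.
  apply: (@le_lt_trans _ _
      (\int[mu]_x (k%:E * (sqnorm (f x))%:E + 2%:E * (sqnorm (g x))%:E))%E).
    apply: ge0_le_integral => //.
    - by apply/measurable_EFinP/measurable_sqnorm/measurable_mxDZ.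
    - apply/measurable_EFinP/measurable_funD; exact: measurable_funM.
    - by move=> x _; rewrite -!EFinM -EFinD lee_fin sqnormDZ.
  rewrite ge0_integralD //; last 4 first.
  - by move=> x _; rewrite mule_ge0 // lee_fin.
  - by apply/measurable_EFinP; exact: measurable_funM.
  - by move=> x _; rewrite mule_ge0 // lee_fin.
  - by apply/measurable_EFinP; exact: measurable_funM.
  rewrite !ge0_integralZl_EFin //; try exact/measurable_EFinP.
  by rewrite lte_add_pinfty // lte_mul_pinfty.
by move=> i x sx; rewrite !mxE f0 // g0 // mulr0 addr0.
Qed.

HB.instance Definition _ := GRing.isSubmodClosed.Build _ _ L2fun_pred
  L2fun_submod_closed.
HB.instance Definition _ := [SubChoice_isSubLmodule of L2fun by <:].

Lemma L2funDZE (a : R[i]) (f g : L2fun) x : (a *: f + g) x = a *: f x + g x.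
Proof. by []. Qed.

Definition L2null : {pred L2fun} := mem [set f : L2fun | {ae mu, forall x, f x = 0}].

Lemma L2null_scale (a : R[i]) (f : L2fun) : f \in L2null -> a *: f \in L2null.
Proof.
rewrite !inE; apply: filterS => x fx0.
by rewrite -[a *: f]addr0 L2funDZE fx0 scaler0 addr0.
Qed.

Lemma L2null_zmod_closed : zmod_closed L2null.
Proof.
split=> [|f g]; first by rewrite inE; apply: aeW.
rewrite !inE; apply: filterS2 => x fx0 gx0.
by rewrite addrC -scaleN1r L2funDZE fx0 gx0 scaler0 addr0.
Qed.

HB.instance Definition _ := GRing.isZmodClosed.Build _ L2null L2null_zmod_closed.

(* The direct sum of the L^2(s i, mu), as classes of functions modulo a.e.
   equality *)
Definition L2sum : Type := Quotient.quot L2null.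

HB.instance Definition _ := GRing.Zmodule.on L2sum.
HB.instance Definition _ := EqQuotient.on L2sum.
HB.instance Definition _ := ZmodQuotient.on L2sum.

Definition L2class (f : L2fun) : L2sum := \pi_(L2sum) f.

Lemma L2classP (f g : L2fun) :
  L2class f = L2class g <-> {ae mu, forall x, f x = g x}.
Proof.
split=> [/eqP|fg].
  rewrite -Quotient.idealrBE inE; apply: filterS => x.
  rewrite addrC -scaleN1r L2funDZE scaleN1r => /eqP.
  by rewrite addrC subr_eq0 => /eqP.
apply/eqP; rewrite -Quotient.idealrBE inE; move: fg; apply: filterS => x fgx.
by rewrite addrC -scaleN1r L2funDZE fgx scaleN1r addNr.
Qed.

Lemma L2classD (f g : L2fun) : L2class (f + g) = L2class f + L2class g.
Proof. exact: pi_addr. Qed.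

Lemma L2class_repr (u : L2sum) : L2class (repr u) = u.
Proof. exact: reprK. Qed.

Definition L2scale (a : R[i]) (u : L2sum) : L2sum := L2class (a *: repr u).

Lemma L2classZ (a : R[i]) (f : L2fun) : L2class (a *: f) = L2scale a (L2class f).
Proof.
apply/L2classP; have /L2classP := L2class_repr (L2class f).
by apply: filterS => x fx; rewrite -[a *: f]addr0 -[a *: repr _]addr0 !L2funDZE fx.
Qed.

Let scaleA a b u : L2scale a (L2scale b u) = L2scale (a * b) u.
Proof. by rewrite -[u]L2class_repr -!L2classZ scalerA. Qed.
Let scale1 : left_id 1 L2scale.
Proof. by move=> u; rewrite -[u]L2class_repr -!L2classZ scale1r. Qed.
Let scaleDr : right_distributive L2scale +%R.
Proof.
move=> a u v; rewrite -[u]L2class_repr -[v]L2class_repr.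
by rewrite -!L2classZ -!L2classD -L2classZ scalerDr.
Qed.
Let scaleDl u : {morph L2scale^~ u : a b / a + b}.
Proof.
by move=> a b; rewrite -[u]L2class_repr -!L2classZ -L2classD scalerDl.
Qed.

HB.instance Definition _ := GRing.Zmodule_isLmodule.Build R[i] L2sum
  scaleA scale1 scaleDr scaleDl.

Definition L2norm (u : L2sum) : R :=
  Num.sqrt (fine (\int[mu]_x (sqnorm (repr u x))%:E)).

Lemma L2normE (f : L2fun) :
  L2norm (L2class f) = Num.sqrt (fine (\int[mu]_x (sqnorm (f x))%:E)).
Proof.
have mF (g : L2fun) : measurable_fun setT (EFin \o (fun x => sqnorm (g x))).
  case: g => g /=; rewrite inE => -[mg _ _].
  by apply/measurable_EFinP/measurable_sqnorm.
have eF (v : 'cV[R[i]]_c) : (0 <= (sqnorm v)%:E)%E by rewrite lee_fin sqnorm_ge0.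
rewrite /L2norm; congr (Num.sqrt (fine _)).
apply: ge0_ae_eq_integral => //; [exact: mF | exact: mF |].
have /L2classP := L2class_repr (L2class f).
by apply: filterS => x fx _; rewrite fx.
Qed.

End L2sum.

Section isometries.
Context d (T : measurableType d) (R : realType) (mu : {measure set T -> \bar R}).
Context (c : nat) (s : 'I_c -> set T).
Local Notation K := (L2sum mu s).

(* [S] is well defined on classes and acts on representatives as [F] *)
Definition acts_as (S : K -> K) (F : (T -> 'cV[R[i]]_c) -> T -> 'cV[R[i]]_c) :=
  forall f : L2fun mu s, exists2 g : L2fun mu s,
    (g : T -> 'cV[R[i]]_c) = F f & S (L2class f) = L2class g.

Definition is_isometry (S : K -> K) : Prop := linear S /\
  forall f, L2norm (S f) = L2norm f.

Definition is_pure_isometry (S : K -> K) : Prop := is_isometry S /\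
  \bigcap_(n in [set: nat]) range (iter n S) = [set 0].

End isometries.

Section filters.
Variables (R : realType) (G : zmodType) (alpha : {additive G -> G}) (N c : nat).
Variable m : dualGroup R G -> 'I_c.+1.
Local Notation dual := (dualGroup R G).

(* With 1-based coordinates this is sigma_(i+1) = {m >= i+1}. *)
Definition sigma (i : 'I_c) : set dual := [set w | (i.+1 <= m w)%N].

Definition Sigma (w : dual) : 'M[R[i]]_c := diag_mx (\row_i \1_(sigma i) w).

Definition adjoint n (A : 'M[R[i]]_n) : 'M[R[i]]_n := (map_mx Num.conj A)^T.

(* The sum over a fibre of the dual endomorphism is finite: fibres are cosets of
   its kernel, whose order is the index N. *)
Definition is_filter (lambda : {measure set dual -> \bar R})
    (H : dual -> 'M[R[i]]_c) : Prop :=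
  [/\ measurable_mx H,
      forall i j w, ~ sigma j w -> H w i j = 0 &
      {ae lambda, forall w,
        \sum_(z \in [set z | dual_endo alpha z = w]) (H z *m adjoint (H z)) =
        N%:R *: Sigma w}].

Definition is_low_pass (a : nat) (H : dual -> 'M[R[i]]_c) : Prop :=
  (\forall w \near (1%g : dual), {for w, continuous H}) /\
  H 1%g = (Num.sqrt N%:R)%:C%C *: pid_mx a.

Definition filter_op (H : dual -> 'M[R[i]]_c) (f : dual -> 'cV[R[i]]_c)
  : dual -> 'cV[R[i]]_c := fun w => (H w)^T *m f (dual_endo alpha w).

End filters.

(* Main.v *)
From HB Require Import structures.
Require Import Defs.
From mathcomp Require Import all_boot all_order all_algebra.
From mathcomp Require Import complex separable ring lra zify.
From mathcomp Require Import all_classical all_reals all_analysis.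
From mathcomp Require Import measurable_realfun.

(** Isometry.  The kernel of the dual endomorphism consists of the [N] characters
    of [G / alpha G], and the endomorphism is onto: both follow from counting the
    extensions of a character of [alpha G] ([character_extensions]).  Hence it
    preserves Haar measure ([haar_unique]), its fibres are cosets of a group of
    order [N], and integrating a function amounts to integrating its mean over the
    fibres.  By the filter equation the mean over a fibre of the squared norm of
    [S f] is the squared norm of [f] at the image point ([filter_transfers]).

    Purity.  Let [f_0 = S^n f_n] for all [n] and [F_n = |f_n|^2].  Then [F_(n+1)] is
    the transfer of [F_n], the mean over fibres.  Transfers contract the L1 norm,
    and they map a character to a character or to zero; the density of the iterated
    kernels makes the iterated transfers of every nonconstant character vanish
    eventually.  Trigonometric polynomials being dense in L1 ([trig_dense]), [F_n]
    tends in L1 to the constant [I], the squared norm of [f_0]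
    ([transfers_equidistributed]).

    Near the identity [H] is close to the matrix that multiplies the first [a]
    coordinates by [sqrt N] and kills the others.  Two consecutive relations
    [f_n(w) = H(w)^t f_(n+1)(phi w)], with [phi] the dual endomorphism, then show
    that the last coordinates of [f_(n+1)] are small and that
    [F_n >= 13/8 F_(n+1) - F_(n+2) / 32] at the corresponding points ([low_pass_two_steps]).  On a neighbourhood of the identity, which has
    positive measure ([open_measure_gt0]), this contradicts the convergence to a
    nonzero constant [I] ([backward_orbit_null]). *)

Set Implicit Arguments.
Unset Strict Implicit.
Unset Printing Implicit Defensive.

Import Order.TTheory GRing.Theory Num.Theory.
Import numFieldNormedType.Exports.

Local Open Scope classical_set_scope.
Local Open Scope ring_scope.

(** * Characters of a subgroup of finite index *)

Lemma nth_roots_uniq (F : numClosedFieldType) (p : nat) (x : F) :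
  (0 < p)%N -> x != 0 ->
  exists zs : seq F, [/\ uniq zs, size zs = p &
    forall z, (z \in zs) = (z ^+ p == x)].
Proof.
move=> p0 x0; have [zs zsE] := closed_field_poly_normal ('X^p - x%:P).
have mon : 'X^p - x%:P \is monic by rewrite monicXnsubC.
move: zsE; rewrite (monicP mon) scale1r => zsE; exists zs; split.
- rewrite -separable_prod_XsubC -zsE unlock /coprimep derivB derivXn derivC subr0.
  have : coprimep ('X^p - x%:P) ('X^(p.-1) *+ p).
    have pF : p%:R != 0 :> F by rewrite pnatr_eq0 -lt0n.
    rewrite -scaler_nat coprimepZr //; apply: coprimep_expr.
    rewrite -['X]subr0 -polyC0 coprimep_XsubC rootE !hornerE.
    by rewrite oppr0 expr0n gtn_eqF // sub0r oppr_eq0.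
  by [].
- have := size_prod_XsubC zs id; rewrite -zsE size_XnsubC //.
  by move=> -[].
- move=> z; rewrite -root_prod_XsubC -zsE rootE !hornerE.
  by rewrite subr_eq0.
Qed.

Lemma flatten_fibres (S T : eqType) (key : T -> S) (fib : S -> seq T)
    (q : nat) (zs : seq S) : uniq zs ->
  (forall z, z \in zs -> [/\ uniq (fib z), size (fib z) = q &
     forall w, w \in fib z -> key w = z]) ->
  uniq (flatten [seq fib z | z <- zs]) /\
  size (flatten [seq fib z | z <- zs]) = (size zs * q)%N.
Proof.
elim: zs => // z zs IH /= /andP[zN uzs] h.
have [uf sf kf] := h z (mem_head _ _).
have [||uF sF] := IH; [by []|by move=> y yz; apply: h; rewrite inE yz orbT|].
split; last by rewrite size_cat sF sf mulSn.
rewrite cat_uniq uf uF andbT /=; apply/hasPn => w /flatten_mapP[y yz wy].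
apply/negP => wz; have [_ _ ky] := h y (mem_behead (s := z :: zs) yz).
by move: zN; rewrite -(kf _ wz) (ky _ wy) yz.
Qed.

Section extension.
Variables (R : realType) (G : zmodType).
Local Notation dual := (dualGroup R G).
Implicit Types (A : set G) (t : seq G) (w : dual) (chi : G -> R[i]).

Lemma dual0 w : w 0 = 1.
Proof.
by apply: (mulfI (dual_neq0 w 0)); rewrite -dualD addr0 mulr1.
Qed.

Lemma dualMn w x n : w (x *+ n) = w x ^+ n.
Proof. by elim: n => [|n IH]; rewrite ?dual0 // mulrS dualD exprS IH. Qed.

Definition subgroup A := A 0 /\ forall x y, A x -> A y -> A (x - y).

Definition covers A t := forall x, exists2 r, r \in t & A (x - r).

Definition transversal A t := [/\ uniq t, covers A t &
  {in t &, forall r r', A (r - r') -> r = r'}].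

Definition character_on A chi := (forall x, A x -> `|chi x| = 1) /\
  forall x y, A x -> A y -> chi (x + y) = chi x * chi y.

Section subgroup_theory.
Variables (A : set G) (gA : subgroup A).

Lemma subgroupN x : A x -> A (- x).
Proof. by move=> Ax; rewrite -sub0r; apply gA => //; case: gA. Qed.

Lemma subgroupD x y : A x -> A y -> A (x + y).
Proof. by move=> Ax /subgroupN Ay; rewrite -[y]opprK; apply gA. Qed.

Lemma subgroupMn x n : A x -> A (x *+ n).
Proof.
by move=> Ax; elim: n => [|n IH]; [case: gA|rewrite mulrS; exact: subgroupD].
Qed.

Variables (chi : G -> R[i]) (cA : character_on A chi).

Lemma character_on0 : chi 0 = 1.
Proof.
have [A0 _] := gA; have [n1 M] := cA.
have c0 : chi 0 != 0 by rewrite -normr_eq0 n1 // oner_eq0.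
by apply: (mulfI c0); rewrite -M // addr0 mulr1.
Qed.

Lemma character_onMn x n : A x -> chi (x *+ n) = chi x ^+ n.
Proof.
move=> Ax; elim: n => [|n IH]; first exact: character_on0.
by rewrite mulrS exprS -IH; apply cA => //; exact: subgroupMn.
Qed.

End subgroup_theory.

Section adjoin.
Variables (A : set G) (gA : subgroup A) (x : G) (p : nat).
Hypotheses (p_gt0 : (0 < p)%N) (px : A (x *+ p)).
Hypothesis p_min : forall n, (0 < n)%N -> A (x *+ n) -> (p <= n)%N.

Definition adjoin : set G := [set y | exists j, A (y - x *+ j)].

Lemma sub_adjoin : A `<=` adjoin.
Proof. by move=> y Ay; exists 0%N; rewrite mulr0n subr0. Qed.

Lemma mem_adjoin : adjoin x.
Proof. by exists 1%N; rewrite mulr1n subrr; case: gA. Qed.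

Lemma adjoin_subgroup : subgroup adjoin.
Proof.
split=> [|y y' [j Aj] [j' Aj']]; first by apply: sub_adjoin; case: gA.
exists (j + p.-1 * j')%N.
have -> : y - y' - x *+ (j + p.-1 * j') =
    (y - x *+ j) - (y' - x *+ j') - (x *+ p) *+ j'.
  rewrite -mulrnA -[in RHS](prednK p_gt0) mulSn !mulrnDr !opprB !opprD !addrA.
  by rewrite [in RHS](addrAC _ (x *+ j') (- y')) addrK (addrAC y (- y')).
by apply gA; [exact: (proj2 gA)|exact: subgroupMn].
Qed.

(** By minimality, [p] is the order of [x] modulo [A]. *)
Lemma dvdn_order n : A (x *+ n) -> (p %| n)%N.
Proof.
move=> An; rewrite /dvdn; apply: contraT; rewrite -lt0n => r0.
have : A (x *+ (n %% p)).
  have -> : x *+ (n %% p) = x *+ n - (x *+ p) *+ (n %/ p).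
    by rewrite {2}(divn_eq n p) mulrnDr mulnC mulrnA addrAC subrr add0r.
  by apply gA => //; exact: subgroupMn.
by move=> /(p_min r0); rewrite leqNgt ltn_mod p_gt0.
Qed.

Lemma adjoin_transversal t : transversal adjoin t ->
  transversal A [seq r + x *+ j | r <- t, j <- iota 0 p].
Proof.
move=> [ut ct it].
have key r r' j j' : r \in t -> r' \in t -> (j < p)%N -> (j' < p)%N ->
    A (r + x *+ j - (r' + x *+ j')) -> r = r' /\ j = j'.
  wlog jj : r r' j j' / (j' <= j)%N.
    move=> W; case: (leqP j' j) => [|/ltnW] jj rt rt' jp jp' Ar; first exact: W.
    have := subgroupN gA Ar; rewrite opprB.
    by move=> /(W _ _ _ _ jj rt' rt jp' jp)[-> ->].
  move=> rt rt' jp jp'.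
  have -> : r + x *+ j - (r' + x *+ j') = r - r' + x *+ (j - j').
    by rewrite mulrnBr // opprD addrACA.
  move=> Ar; have rr : r = r'.
    apply: it => //; have gB := adjoin_subgroup.
    rewrite -[_ - _](addrK (x *+ (j - j'))); apply gB; first exact: sub_adjoin.
    by apply: (subgroupMn gB); exact: mem_adjoin.
  split=> //; move: Ar; rewrite rr subrr add0r => /dvdn_order.
  case: (ltngtP j' j) jj => // jj _.
  by move=> /(dvdn_leq _); rewrite subn_gt0 jj => /(_ isT); lia.
split.
- apply: allpairs_uniq => //; first exact: iota_uniq.
  move=> [r j] [r' j'] /allpairsP[[? ?] /= [rt + [-> ->]]].
  rewrite mem_iota /= add0n => jp.
  move=> /allpairsP[[? ?] /= [rt' + [-> ->]]].
  rewrite mem_iota /= add0n => jp' e.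
  have [] := key _ _ _ _ rt rt' jp jp'; first by rewrite e subrr; case: gA.
  by move=> -> ->.
- move=> y; have [r rt [j Aj]] := ct y.
  exists (r + x *+ (j %% p)).
    by apply/allpairsP; exists (r, j %% p)%N; rewrite mem_iota /= add0n ltn_mod.
  have -> : y - (r + x *+ (j %% p)) = y - r - x *+ j + (x *+ p) *+ (j %/ p).
    rewrite {2}(divn_eq j p) mulrnDr mulnC mulrnA !opprD !addrA.
    by rewrite [RHS]addrAC subrK.
  by apply: subgroupD => //; exact: subgroupMn.
- move=> ? ? /allpairsP[[r j] /= [rt + ->]]; rewrite mem_iota /= add0n => jp.
  move=> /allpairsP[[r' j'] /= [rt' + ->]]; rewrite mem_iota /= add0n => jp' e.
  by have [-> ->] := key _ _ _ _ rt rt' jp jp' e.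
Qed.

Variables (chi : G -> R[i]) (cA : character_on A chi) (z : R[i]).
Hypothesis zp : z ^+ p = chi (x *+ p).

(** The extension of [chi] to [A + Z x] that sends [x] to [z]; the exponent [j]
    of a decomposition [y = a + j x] is only determined modulo [p], which
    [extend_charE] shows to be harmless. *)
Definition extend_char (y : G) : R[i] :=
  let j := xget 0%N [set j | A (y - x *+ j)] in chi (y - x *+ j) * z ^+ j.

Lemma extend_charE y j : A (y - x *+ j) ->
  extend_char y = chi (y - x *+ j) * z ^+ j.
Proof.
have gen i k : (i <= k)%N -> A (y - x *+ i) -> A (y - x *+ k) ->
    chi (y - x *+ i) * z ^+ i = chi (y - x *+ k) * z ^+ k.
  move=> ik Ai Ak.
  have e : y - x *+ i = y - x *+ k + x *+ (k - i).
    by rewrite mulrnBr // addrA subrK.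
  have Ax : A (x *+ (k - i)).
    have -> : x *+ (k - i) = y - x *+ i - (y - x *+ k).
      by rewrite mulrnBr // opprB addrCA addrAC subrr add0r addrC.
    by apply gA.
  have /dvdnP[l lE] := dvdn_order Ax.
  have -> : z ^+ k = z ^+ (k - i) * z ^+ i by rewrite -exprD subnK.
  rewrite e (proj2 cA) // lE mulrA; congr (_ * _ * _).
  by rewrite mulnC mulrnA exprM zp; exact: (character_onMn gA cA).
move=> Aj; rewrite /extend_char; set i := xget _ _.
have Ai : A (y - x *+ i) by have := @xgetPex _ 0%N [set j | A (y - x *+ j)];
  move=> /(_ (ex_intro _ j Aj)).
by case: (leqP i j) => [|/ltnW] ij; [|symmetry]; exact: gen.
Qed.

Lemma extend_char_id y : A y -> extend_char y = chi y.
Proof.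
by move=> Ay; rewrite (@extend_charE y 0) mulr0n subr0 // expr0 mulr1.
Qed.

Lemma extend_char_root : extend_char x = z.
Proof.
rewrite (@extend_charE x 1) mulr1n subrr; last by case: gA.
by rewrite (character_on0 gA cA) mul1r expr1.
Qed.

Lemma extend_char_on : character_on adjoin extend_char.
Proof.
have z1 : `|z| = 1.
  by apply/eqP; rewrite -(pexpr_eq1 p_gt0) // -normrX zp (proj1 cA).
split=> [y [j Aj]|y y' [j Aj] [j' Aj']].
  by rewrite (extend_charE Aj) normrM normrX z1 expr1n mulr1 (proj1 cA).
have e : y + y' - x *+ (j + j') = (y - x *+ j) + (y' - x *+ j').
  by rewrite mulrnDr opprD addrACA.
rewrite (extend_charE Aj) (extend_charE Aj') (@extend_charE _ (j + j')).
  by rewrite e (proj2 cA) // exprD mulrACA.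
by rewrite e; exact: subgroupD.
Qed.

End adjoin.

Lemma order_mod_exists A t x : subgroup A -> covers A t ->
  exists p, [/\ (0 < p)%N, A (x *+ p) &
    forall n, (0 < n)%N -> A (x *+ n) -> (p <= n)%N].
Proof.
move=> gA cov.
have ex : exists p, (0 < p)%N && `[< A (x *+ p) >].
  have /choice[f fP] : forall j : 'I_(size t).+1, exists i : 'I_(size t),
      A (x *+ j - t`_i).
    move=> j; have [r rt Ar] := cov (x *+ j).
    have it : (index r t < size t)%N by rewrite index_mem.
    by exists (Ordinal it); rewrite /= nth_index.
  have /injectivePn[i [j ij fij]] : ~~ injectiveb f.
    by apply/negP => /injectiveP /leq_card; rewrite !card_ord ltnn.
  have {ij fij}: exists k l : nat, (k < l)%N /\ A (x *+ l - x *+ k).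
    have Aij : A (x *+ i - x *+ j).
      have -> : x *+ i - x *+ j = (x *+ i - t`_(f i)) - (x *+ j - t`_(f i)).
        by rewrite opprB addrA subrK.
      by apply gA => //; rewrite fij.
    have [ij'|ij'|/val_inj ij'] := ltngtP i j; last by rewrite ij' eqxx in ij.
      by exists i, j; split=> //; rewrite -opprB; exact: subgroupN.
    by exists j, i.
  move=> [k [l [kl Akl]]]; exists (l - k)%N; rewrite subn_gt0 kl /=.
  by apply/asboolP; rewrite mulrnBr // ltnW.
case: (ex_minnP ex) => p /andP[p0 /asboolP Ap] pmin; exists p; split=> // n n0 An.
by apply: pmin; rewrite n0; apply/asboolP.
Qed.

(** A character of a subgroup of finite index has exactly as many extensions to
    the whole group as the index: adjoining one element of relative order [p]
    multiplies both numbers by [p], the new values being the [p]-th roots of a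
    number of modulus one. *)
Lemma character_extensions A t : subgroup A -> covers A t ->
  exists2 t', transversal A t' & forall chi, character_on A chi ->
    exists s : seq dual, [/\ uniq s, size s = size t' &
      forall w, w \in s <-> forall x, A x -> w x = chi x].
Proof.
move: {2}(size t) (leqnn (size t)) => n.
elim: n A t => [|n IH] A t tn gA cov.
  by have [r] := cov 0; move: tn; rewrite leqn0 => /nilP ->.
have [Aall|/existsNP[x nAx]] := pselect (forall x, A x).
  exists [:: 0]; first split => //.
  - by move=> x; exists 0; rewrite ?mem_head.
  - by move=> r r'; rewrite !inE => /eqP-> /eqP->.
  move=> chi [c1 cD].
  pose w0 : dual := Dual (fun x => c1 x (Aall x))
    (fun x y => cD x y (Aall x) (Aall y)).
  exists [:: w0]; split=> // w; rewrite inE; split=> [/eqP-> //|e].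
  by apply/eqP/dualP => x; exact: e.
have [p [p0 Ap pmin]] := order_mod_exists x gA cov.
have gB := adjoin_subgroup gA p0 Ap.
have AB := @sub_adjoin A x; have xB := mem_adjoin gA x.
(* [r0] and [r1] represent the cosets of [0] and [x], which merge in the larger
   subgroup: dropping [r1] leaves a shorter covering list. *)
have [r0 r0t Ar0] := cov 0; have [r1 r1t Ar1] := cov x.
pose t1 := [seq r <- t | r != r1].
have [] := IH (adjoin A x) t1 => //.
- rewrite -ltnS; apply: leq_trans tn.
  rewrite size_filter -(count_predC (pred1 r1) t) -addn1 addnC leq_add2r.
  by rewrite -has_count; apply/hasP; exists r1 => /=.
- move=> y; have [r rt Ar] := cov y.
  have [e|rr1] := eqVneq r r1; last first.
    by exists r; [rewrite mem_filter rr1|exact: AB].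
  exists r0.
    rewrite mem_filter r0t andbT; apply/eqP => e01; apply: nAx.
    have -> : x = (x - r1) - (0 - r0) by rewrite sub0r opprK e01 subrK.
    by apply gA.
  have -> : y - r0 = (y - r) - (x - r1) + (0 - r0) + x.
    by rewrite e sub0r opprB !addrA subrK (addrAC _ (- r0)) subrK.
  apply: subgroupD => //; apply: AB; apply: subgroupD => //; exact: (proj2 gA).
move=> t2 tr2 ext; exists [seq r + x *+ j | r <- t2, j <- iota 0 p].
  exact: (adjoin_transversal gA p0 Ap pmin tr2).
move=> chi cA.
have cpx0 : chi (x *+ p) != 0 by rewrite -normr_eq0 (proj1 cA) ?oner_eq0.
have [zs [uzs szs zsP]] := nth_roots_uniq p0 cpx0.
have zsE z : z \in zs -> z ^+ p = chi (x *+ p) by rewrite zsP => /eqP.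
have /choice[sf sfP] : forall z, exists s : seq dual, z \in zs ->
    [/\ uniq s, size s = size t2 & forall w, w \in s <->
      forall y, adjoin A x y -> w y = extend_char A x chi z y].
  move=> z; have [zz|_] := boolP (z \in zs); last by exists [::].
  have [s sP] := ext _ (extend_char_on gA p0 Ap pmin cA (zsE _ zz)).
  by exists s.
have [|us ss] := @flatten_fibres _ _ (fun w : dual => w x) sf (size t2) zs uzs.
  move=> z zz; have [us ss sE] := sfP _ zz; split=> // w /sE /(_ _ xB) /= ->.
  exact: (extend_char_root gA p0 Ap pmin cA (zsE _ zz)).
exists (flatten [seq sf z | z <- zs]); split=> //.
  by rewrite ss szs size_allpairs size_iota mulnC.
move=> w; split.
  move=> /flatten_mapP[z zz]; have [_ _ sE] := sfP _ zz.
  move=> /sE e y Ay; rewrite e; last exact: AB.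
  exact: (extend_char_id gA p0 Ap pmin cA (zsE _ zz)).
move=> wA.
have wz : w x \in zs by rewrite zsP -dualMn wA.
apply/flatten_mapP; exists (w x) => //; have [_ _ sE] := sfP _ wz.
apply/sE => y [j Aj].
rewrite (extend_charE gA p0 Ap pmin cA (zsE _ wz) Aj) -wA // -dualMn -dualD.
by rewrite subrK.
Qed.

End extension.

Section dual_endomorphism.
Variables (R : realType) (G : zmodType) (alpha : {additive G -> G}).
Variables (alpha_inj : injective alpha) (N : nat).
Hypothesis alpha_index : (image_cosets alpha #= `I_N)%card.
Local Notation dual := (dualGroup R G).
Local Notation "alpha ^*" := (@dual_endo R G alpha).

Lemma dual_endo1 : alpha^* 1%g = 1%g.
Proof. exact: dualP. Qed.

Lemma dual_endoM u v : alpha^* (u * v)%g = (alpha^* u * alpha^* v)%g.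
Proof. exact: dualP. Qed.

Lemma dual_endoV u : alpha^* (u^-1)%g = ((alpha^* u)^-1)%g.
Proof. exact: dualP. Qed.

Let range_subgroup : subgroup (range alpha).
Proof.
split=> [|_ _ [x _ <-] [y _ <-]]; first by exists 0; rewrite // raddf0.
by exists (x - y); rewrite // raddfB.
Qed.

Let range_covers : exists t, covers (range alpha) t.
Proof.
have fc : finite_set (image_cosets alpha) by apply/finite_setP; exists N.
have [s sE] := (finite_seqP (image_cosets alpha)).1 fc.
exists [seq xget 0 C | C <- s] => x.
pose C := [set x + alpha y | y in [set: G]].
have Cs : C \in s.
  have : image_cosets alpha C by exists x.
  by rewrite sE.
exists (xget 0 C); first by apply/mapP; exists C.
have Cx : C x by exists 0; rewrite // raddf0 addr0.
have := @xgetPex _ 0 C (ex_intro _ x Cx) => -[y _ <-].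
by exists (- y); rewrite // raddfN opprD addrA subrr add0r.
Qed.

Lemma size_range_transversal t : transversal (range alpha) t -> size t = N.
Proof.
move=> [ut ct it]; apply/card_eq_II.
pose f i := [set t`_i + alpha y | y in [set: G]].
have mem_f i x : f i x <-> range alpha (x - t`_i).
  split=> [[y _ <-]|[y _ e]]; last by exists y; rewrite // e addrC subrK.
  by exists y; rewrite // addrAC subrr add0r.
have f_img : image_cosets alpha = f @` `I_(size t).
  apply/seteqP; split=> [_ [x _ <-]|_ [i _ <-]]; last by exists t`_i.
  have [r rt xr] := ct x; exists (index r t) => /=; first by rewrite index_mem.
  apply/seteqP; split=> y.
    move=> /mem_f; rewrite nth_index // => yr; case: xr => u _ uE.
    case: yr => v _ vE; exists (v - u); rewrite // raddfB uE vE.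
    by rewrite opprB [y - _ + _]addrA subrK addrCA subrr addr0.
  move=> [z _ <-]; apply/mem_f; rewrite nth_index // addrAC.
  by case: xr => u _ <-; exists (u + z); rewrite // raddfD.
apply: card_eq_trans alpha_index; rewrite f_img card_eq_sym.
apply: inj_card_eq => i j; rewrite !inE /= => it' jt e.
apply/eqP; rewrite -(nth_uniq 0 it' jt ut); apply/eqP.
apply: it; rewrite ?mem_nth //; apply/mem_f; rewrite -e; apply/mem_f.
by rewrite subrr; exists 0; rewrite // raddf0.
Qed.

Let endo_extends u w : alpha^* w = u <->
  forall x, range alpha x -> w x = u (xget 0 [set y | alpha y = x]).
Proof.
have inv y : xget 0 [set z | alpha z = alpha y] = y.
  by apply: alpha_inj; have := @xgetPex _ 0 [set z | alpha z = alpha y];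
    apply; exists y.
split=> [<- _ [y _ <-]|e]; first by rewrite inv.
by apply: dualP => y /=; rewrite e ?inv //; exists y.
Qed.

Let dual_endo_fibre u : exists s : seq dual, [/\ uniq s, size s = N &
  forall w, w \in s <-> alpha^* w = u].
Proof.
have [t ct] := range_covers.
have [t' tr ext] := character_extensions R range_subgroup ct.
have inv y : xget 0 [set z | alpha z = alpha y] = y.
  by apply: alpha_inj; have := @xgetPex _ 0 [set z | alpha z = alpha y];
    apply; exists y.
have [|s [us ss sE]] := ext (fun x => u (xget 0 [set y | alpha y = x])).
  split=> [x _|_ _ [x _ <-] [y _ <-]]; first exact: dual_norm1.
  by rewrite -raddfD !inv dualD.
exists s; split=> //; first by rewrite ss; exact: size_range_transversal tr.
by move=> w; rewrite sE endo_extends.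
Qed.

Lemma dual_endo_ker : exists ks : seq dual, [/\ uniq ks, size ks = N &
  forall k, (k \in ks) <-> alpha^* k = 1%g].
Proof. exact: dual_endo_fibre. Qed.

Lemma dual_endo_surj : (0 < N)%N -> forall u, exists w, alpha^* w = u.
Proof.
move=> N0 u; have [[|w s] [_ ss sE]] := dual_endo_fibre u.
  by move: N0; rewrite -ss.
by exists w; apply/sE; rewrite mem_head.
Qed.

(** Otherwise all [N] characters of the quotient by [range alpha] would be trivial
    on the strictly larger subgroup generated by [g], which has a smaller index and
    hence fewer than [N] characters. *)
Lemma ker_separates g : ~ range alpha g ->
  exists2 k : dual, alpha^* k = 1%g & k g != 1.
Proof.
move=> ng; apply: contrapT => nk.
have [t ct] := range_covers; have gA := range_subgroup.
have [p [p0 Ap pmin]] := order_mod_exists g gA ct.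
have gB := adjoin_subgroup gA p0 Ap.
have AB := @sub_adjoin _ (range alpha) g.
have ctB : covers (adjoin (range alpha) g) t.
  by move=> x; have [r rt Ar] := ct x; exists r => //; exact: AB.
have [tB trB ext] := character_extensions R gB ctB.
have [|s [us ss sE]] := ext (fun=> 1).
  by split=> [x _|x y _ _]; rewrite ?normr1 ?mulr1.
have [ks [uks sks kE]] := dual_endo_fibre 1%g.
have kss : {subset ks <= s}.
  move=> k /kE k1; apply/sE => x [j [y _ yE]].
  have kg : k g = 1 by apply/eqP; apply: contrapT => /negP kg; apply: nk; exists k.
  rewrite -[x](subrK (g *+ j)) dualD dualMn kg expr1n mulr1 -yE.
  by have /(congr1 (fun f : dual => f y)) := k1.
have := uniq_leq_size uks kss; rewrite sks ss.
have := size_range_transversal (adjoin_transversal gA p0 Ap pmin trB).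
rewrite size_allpairs size_iota => <-.
have tB0 : (0 < size tB)%N.
  by case: trB => _ /(_ 0)[r rt _] _; case: (tB) rt.
by rewrite -[leqRHS]muln1 leq_pmul2l //; case: p p0 Ap {pmin} => [|[|p]] //.
Qed.

Lemma index_gt0 : (0 < N)%N.
Proof.
have [t ct] := range_covers.
have [t' tr _] := character_extensions R range_subgroup ct.
rewrite -(size_range_transversal tr); case: tr => _ /(_ 0)[r rt _] _.
by case: (t') rt.
Qed.

End dual_endomorphism.

(** * Topology and Borel sets of the dual group *)

Lemma cvg_initial (S : choiceType) (T : topologicalType) (f : S -> T)
    (F : set_system S) (s : S) : Filter F ->
  f @ F --> f s -> F --> (s : initial_topology f).
Proof.
move=> FF h A; rewrite nbhsE => -[B [[C oC <-] Cs] BA].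
by apply: filterS BA _; apply: h; exact: open_nbhs_nbhs.
Qed.

Section dual_topology.
Variables (R : realType) (G : zmodType).
Local Notation dual := (dualGroup R G).

Lemma dual_cvg (F : set_system dual) (w : dual) : Filter F ->
  (forall g, (v g) @[v --> F] --> w g) -> F --> w.
Proof.
move=> FF h; apply: cvg_initial.
apply/cvg_sup => g; apply: cvg_initial; exact: h.
Qed.

Lemma dual_eval_continuous (g : G) : continuous (fun w : dual => w g).
Proof.
move=> w; apply: (@continuous_comp _ _ _ (@dual_fun R G : dual -> {ptws G -> R[i]})
  (fun f : {ptws G -> R[i]} => f g)).
  exact: initial_continuous.
exact: proj_continuous.
Qed.

Lemma Re_continuous : continuous (@complex.Re R : R[i] -> R).
Proof.
move=> z A [e /= e0 eA].
exists e%:C%C => [|y /= zy]; first by rewrite /= ltcR.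
apply: eA; rewrite /= -ltcR; apply: le_lt_trans zy.
by have := normc_ge_Re (z - y); case: (z) (y) => ? ? [].
Qed.

Lemma dual_continuous (T : topologicalType) (f : T -> dual) :
  (forall g, continuous (fun x => f x g)) -> continuous f.
Proof.
move=> h x; have FF : Filter (f y @[y --> x]) := fmap_filter f (nbhs_filter x).
by apply: dual_cvg => g; exact: h.
Qed.

Lemma dual_mul_continuous (u : dual) : continuous (fun w : dual => (u * w)%g).
Proof.
apply: dual_continuous => g w.
apply: (@cvgM _ _ _ (nbhs_filter w)).
  exact: (@cvg_cst _ _ _ _ (nbhs_filter w)).
exact: dual_eval_continuous.
Qed.

Lemma dual_inv_continuous : continuous (fun w : dual => (w^-1)%g).
Proof.
apply: dual_continuous => g w.
apply: (@cvgV _ _ _ (nbhs_filter w)); first exact: dual_neq0.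
exact: dual_eval_continuous.
Qed.

Lemma dual_endo_continuous (alpha : {additive G -> G}) :
  continuous (@dual_endo R G alpha).
Proof. by apply: dual_continuous => g w; exact: dual_eval_continuous. Qed.

Definition halfplane (a : R[i]) (g : G) (t : R) : set dual :=
  [set v | t < complex.Re (a * v g)].

Lemma dual_Re_continuous a g :
  continuous (fun v : dual => complex.Re (a * v g)).
Proof.
have mulc : continuous (fun v : dual => a * v g).
  move=> v; apply: (@cvgM _ _ _ (nbhs_filter v)).
    exact: (@cvg_cst _ _ _ _ (nbhs_filter v)).
  exact: dual_eval_continuous.
by move=> v; exact: (continuous_comp (mulc v) (@Re_continuous _)).
Qed.

Lemma halfplane_open a g t : open (halfplane a g t).
Proof.
have /continuousP h := @dual_Re_continuous a g.
by rewrite [X in open X](_ : _ = (fun v : dual => complex.Re (a * v g)) @^-1`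
  [set x | t < x]) //; apply: h; exact: open_gt.
Qed.

Lemma dual_open_measurable (A : set dual) : open A -> measurable A.
Proof. exact: sub_sigma_algebra. Qed.

Lemma halfplane_measurable a g t : measurable (halfplane a g t).
Proof. apply: dual_open_measurable; exact: halfplane_open. Qed.

Lemma measurable_Re_eval a g :
  measurable_fun [set: dual] (fun v : dual => complex.Re (a * v g)).
Proof.
apply: (measurability _ (RGenOInfty.measurableE R)) => _ [_ [t ->] <-].
rewrite setTI [X in measurable X](_ : _ = halfplane a g t).
  exact: halfplane_measurable.
by apply/seteqP; split=> v /=; rewrite in_itv /= andbT.
Qed.

(** Evaluations at countably many points and rational half-planes give a
    countable base of the topology, whence a generating family of the Borel
    sets. *)
Section countable_base.
Variables (code : G -> nat) (code_inj : injective code).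

Definition direction (b s : bool) : R[i] := (-1) ^+ s * (if b then 'i%C else 1).

Definition basic_open (l : seq (nat * bool * bool * rat)) : set dual :=
  [set v | forall k b s q, (k, b, s, q) \in l ->
     forall g, code g = k -> halfplane (direction b s) g (ratr q) v].

Lemma nbhs_basic (w : dual) (A : set dual) : nbhs w A ->
  exists l, basic_open l w /\ basic_open l `<=` A.
Proof.
pose F : set_system dual := [set A | exists l, basic_open l w /\ basic_open l `<=` A].
have FF : Filter F.
  split.
  - by exists [::]; split.
  - move=> P Q [l [lw lP]] [l' [lw' lQ]]; exists (l ++ l'); split.
      by move=> k b s q; rewrite mem_cat => /orP[/lw|/lw']; exact.
    move=> v lv; split; [apply: lP|apply: lQ] => k b s q kl; apply: lv;
      by rewrite mem_cat kl ?orbT.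
  - by move=> P Q PQ [l [lw lP]]; exists l; split=> //; exact: subset_trans PQ.
suff : F --> w by apply.
apply: dual_cvg => g B [e /= e0 eB].
have [r r0 re] : exists2 r : R, 0 < r & e = r%:C%C.
  case: e e0 {eB} => x y; rewrite ltcE /= => /andP[/eqP y0 x0].
  by exists x; rewrite ?y0.
have /choice[q qP] : forall bs : bool * bool, exists q : rat,
    complex.Re (direction bs.1 bs.2 * w g) - r / 2 < ratr q <
    complex.Re (direction bs.1 bs.2 * w g).
  move=> bs; have [|q] := @rat_in_itvoo R (complex.Re (direction bs.1 bs.2 * w g)
    - r / 2) (complex.Re (direction bs.1 bs.2 * w g)).
    by rewrite ltrBlDr ltrDl divr_gt0.
  by rewrite in_itv /=; exists q.
exists [seq (code g, b, s, q (b, s)) | b <- [:: true; false],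
  s <- [:: true; false]]; split.
  move=> k b s q' /allpairsP[[b' s'] /= [_ _ [-> -> -> ->]]] h /code_inj ->.
  by have /andP[] := qP (b', s').
move=> v lv; apply: eB; rewrite /= re normc_def ltcR.
have bnd b s : complex.Re (direction b s * w g) - r / 2 <
    complex.Re (direction b s * v g).
  have /andP[qw _] := qP (b, s); apply: lt_trans qw _.
  apply: (lv (code g) b s (q (b, s))) => //.
  by apply/allpairsP; exists (b, s); split=> //; rewrite !inE; case: b s => [] [].
have := (bnd true true, bnd true false, bnd false true, bnd false false).
rewrite /direction !expr0 !expr1 !mul1r !mulN1r.
case: (v g) (w g) => x y [x' y'] /=.
rewrite !(mulNr, mul1r, mul0r, oppr0, add0r, addr0, sub0r, opprK).
move=> [[[h1 h2] h3] h4].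
rewrite -[ltRHS]ger0_norm ?ltW // -sqrtr_sqr ltr_sqrt ?exprn_gt0 //.
have sq (d : R) : - (r / 2) < d -> d < r / 2 -> d ^+ 2 < (r / 2) ^+ 2.
  move=> d1 d2; rewrite -subr_gt0 subr_sqr mulr_gt0 //; lra.
have := sq (x' - x); have := sq (y' - y) => hy hx.
apply: (@lt_le_trans _ _ ((r / 2) ^+ 2 + (r / 2) ^+ 2)).
  by apply: ltrD; [apply: hx|apply: hy]; lra.
by have := sqr_ge0 r; rewrite expr2 => ?; rewrite !expr2; lra.
Qed.

Lemma open_bigcup_basic (A : set dual) : open A ->
  A = \bigcup_(l in [set l | basic_open l `<=` A]) basic_open l.
Proof.
move=> oA; apply/seteqP; split=> [w Aw|w [l /= lA lw]]; last exact: lA.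
by have [l [lw lA]] := nbhs_basic (open_nbhs_nbhs (conj oA Aw)); exists l.
Qed.

End countable_base.

Definition halfplanes : set (set dual) :=
  [set A | exists a g t, A = halfplane a g t].

Lemma dual_measurableE : countable [set: G] ->
  (measurable : set (set dual)) = <<s halfplanes>>.
Proof.
move=> /countable_injP[code inj].
have code_inj : injective code by move=> x y; apply: inj; rewrite inE.
apply/seteqP; split; apply: smallest_sub.
- exact: smallest_sigma_algebra.
- move=> A oA; rewrite (open_bigcup_basic code_inj oA).
  pose T := g_sigma_algebraType halfplanes.
  have mB l : measurable (basic_open code l : set T).
    elim: l => [|[[[k b] s] q] l IH].
      by rewrite [X in measurable X](_ : _ = setT) //; apply/seteqP; split.
    rewrite [X in measurable X](_ : _ =
      [set v | forall g, code g = k -> halfplane (direction b s) g (ratr q) v]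
      `&` basic_open code l).
      apply: measurableI => //.
      have [[g gk]|nog] := pselect (exists g, code g = k).
        rewrite [X in measurable X](_ : _ = halfplane (direction b s) g (ratr q)).
          by apply: sub_sigma_algebra; exists (direction b s), g, (ratr q).
        apply/seteqP; split=> v; first by apply.
        by move=> vg g' g'k; have -> : g' = g by apply: code_inj; rewrite gk.
      rewrite [X in measurable X](_ : _ = setT) //; apply/seteqP; split=> // v _.
      by move=> g gk; exfalso; apply: nog; exists g.
    apply/seteqP; split=> v.
      move=> h; split.
        by move=> g; apply: h; rewrite mem_head.
      by move=> k' b' s' q' kl; apply: h; rewrite inE kl orbT.
    move=> [h1 h2] k' b' s' q'; rewrite inE => /orP[/eqP[-> -> -> ->]|].
      exact: h1.
    exact: h2.
  rewrite bigcup_mkcond; apply: (@countable_bigcupT_measurable _ T).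
    exact: countableP.
  by move=> l; case: ifP.
- by apply: (@sigma_algebra_measurable _ dual).
- by move=> _ [a [g [t ->]]]; exact: halfplane_measurable.
Qed.

End dual_topology.

(** * Haar measure *)

Section measure_preserving.
Context d (T : measurableType d) (R : realType) (mu : {measure set T -> \bar R}).

Definition measure_preserving (phi : T -> T) := measurable_fun setT phi /\
  forall A, measurable A -> mu (phi @^-1` A) = mu A.

Variables (phi : T -> T) (phiP : measure_preserving phi).

Lemma integral_measure_preserving (F : T -> \bar R) : measurable_fun setT F ->
  (forall x, 0 <= F x)%E -> (\int[mu]_x F (phi x) = \int[mu]_x F x)%E.
Proof.
move=> mF F0; have [mphi pphi] := phiP.
pose mphi_mixin := isMeasurableFun.Build _ _ _ _ _ mphi.
pose X : {mfun T >-> T} := HB.pack phi mphi_mixin.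
rewrite [RHS](@eq_measure_integral _ _ _ setT (pushforward mu X)); last first.
  by move=> A mA _; rewrite /= /pushforward pphi.
by rewrite [RHS]ge0_integral_pushforward.
Qed.

Lemma ae_measure_preserving (P : T -> Prop) :
  {ae mu, forall x, P x} -> {ae mu, forall x, P (phi x)}.
Proof.
move=> [A [mA A0 PA]]; have [mphi pphi] := phiP.
exists (phi @^-1` A); split; last by move=> x /= nP; apply: PA.
  by rewrite -[X in measurable X]setTI; exact: mphi.
by rewrite pphi.
Qed.

End measure_preserving.

Section haar.
Variables (R : realType) (G : zmodType) (G_countable : countable [set: G]).
Local Notation dual := (dualGroup R G).

Lemma dual_mulC (u v : dual) : (u * v)%g = (v * u)%g.
Proof. by apply: dualP => g /=; rewrite mulrC. Qed.

Lemma measurable_into_dual d (T : measurableType d) (f : T -> dual) :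
  (forall a g, measurable_fun setT (fun x => complex.Re (a * f x g))) ->
  measurable_fun setT f.
Proof.
move=> mf; apply: (measurability _ (dual_measurableE R G_countable)).
move=> _ [_ [a [g [t ->]]] <-].
have := mf a g measurableT `]t, +oo[%classic (measurable_itv _).
congr (measurable (_ `&` _)).
by apply/seteqP; split=> x /=; rewrite in_itv /= andbT.
Qed.

Lemma measurable_dual_mul :
  measurable_fun setT (fun p : dual * dual => (p.1 * p.2)%g).
Proof.
apply: measurable_into_dual => a g.
have E (p : dual * dual) : complex.Re (a * (p.1 * p.2)%g g) =
    complex.Re (a * p.1 g) * complex.Re (1 * p.2 g) -
    complex.Re ('i%C * a * p.1 g) * complex.Re ('i%C * p.2 g).
  case: p => u v /=; case: a (u g) (v g) => a b [x y] [z t] /=; ring.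
under eq_fun do rewrite E.
have m1 b : measurable_fun setT (fun p : dual * dual => complex.Re (b * p.1 g)).
  exact: (measurableT_comp (measurable_Re_eval b g) measurable_fst).
have m2 b : measurable_fun setT (fun p : dual * dual => complex.Re (b * p.2 g)).
  exact: (measurableT_comp (measurable_Re_eval b g) measurable_snd).
by apply: measurable_funB; apply: measurable_funM.
Qed.

Lemma measurable_dual_endo (alpha : {additive G -> G}) :
  measurable_fun setT (@dual_endo R G alpha).
Proof.
by apply: measurable_into_dual => a g /=; exact: measurable_Re_eval.
Qed.

Lemma measurable_translation (u : dual) :
  measurable_fun setT (fun v : dual => (u * v)%g).
Proof.
apply: measurable_into_dual => a g.
under eq_fun do rewrite /= mulrA.
exact: measurable_Re_eval.
Qed.

Lemma translation_preserving (mu : {measure set dual -> \bar R}) :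
  translation_invariant mu ->
  forall u, measure_preserving mu (fun v : dual => (u * v)%g).
Proof.
move=> inv u; split; first exact: measurable_translation.
move=> A mA; rewrite -[RHS](inv (u^-1)%g A mA); congr (mu _).
apply/seteqP; split=> [v Av|_ [v Av <-]] /=; last by rewrite mulVKg.
by exists (u * v)%g; rewrite // mulKg.
Qed.

(** Both iterated integrals of [(u, v) |-> 1_A (u v)] are computed by
    invariance, one of them giving each measure. *)
Lemma haar_unique (mu nu : probability dual R) :
  (forall u, measure_preserving mu (fun v : dual => (u * v)%g)) ->
  (forall u, measure_preserving nu (fun v : dual => (u * v)%g)) ->
  forall A, measurable A -> mu A = nu A.
Proof.
move=> imu inu A mA.
pose B := (fun p : dual * dual => (p.1 * p.2)%g) @^-1` A.
have mB : measurable B.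
  by rewrite -[X in measurable X]setTI; exact: measurable_dual_mul.
have <- : (mu \x nu)%E B = nu A.
  rewrite /product_measure1 (eq_integral (cst (nu A))) => [|u _ /=].
    by rewrite integral_cst // [X in (_ * X)%E]probability_setT mule1.
  rewrite -(proj2 (inu u) A mA); congr (nu _).
  by apply/seteqP; split=> v; rewrite /xsection /= inE.
have <- : (mu \x^ nu)%E B = mu A.
  rewrite /product_measure2 (eq_integral (cst (mu A))) => [|v _ /=].
    by rewrite integral_cst // [X in (_ * X)%E]probability_setT mule1.
  rewrite -(proj2 (imu v) A mA); congr (mu _).
  by apply/seteqP; split=> u; rewrite /ysection /= inE /= /B /= dual_mulC.
symmetry; apply: (@product_measure_unique _ _ _ _ _ mu nu (mu \x^ nu)%E) => //.
exact: product_measure2E.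
Qed.

(** The image of Haar measure under a surjective endomorphism is again translation
    invariant, so [haar_unique] applies. *)
Lemma dual_endo_preserving (alpha : {additive G -> G}) (mu : probability dual R) :
  translation_invariant mu ->
  (forall u, exists w, dual_endo alpha w = u :> dual) ->
  measure_preserving mu (@dual_endo R G alpha).
Proof.
move=> /translation_preserving inv surj.
have mphi := measurable_dual_endo alpha; split=> // A mA.
pose mphi_mixin := isMeasurableFun.Build _ _ _ _ _ mphi.
pose X : {mfun dual >-> dual} := HB.pack (@dual_endo R G alpha) mphi_mixin.
apply: (@haar_unique (distribution mu X) mu) => // u.
split=> [|B mB]; first exact: measurable_translation.
have [w wu] := surj u; rewrite /distribution /pushforward /=.
rewrite -[RHS](proj2 (inv w)); last first.
  by rewrite -[X in measurable X]setTI; apply: (measurable_dual_endo alpha).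
congr (mu _); apply/seteqP; split=> v /=;
  by rewrite dual_endoM wu.
Qed.

End haar.

(** * The transfer relation *)

Section sqnorm_theory.
Variable R : realType.

Lemma sqnormE c (u : 'cV[R[i]]_c) :
  (sqnorm u)%:C%C = (u^T *m map_mx Num.conj u) 0 0.
Proof.
rewrite !mxE /sqnorm raddf_sum; apply: eq_bigr => i _.
by rewrite !mxE /= -normCK -add_Re2_Im2.
Qed.

Lemma sqnorm_trmul c (A : 'M[R[i]]_c) (u : 'cV[R[i]]_c) :
  (sqnorm (A^T *m u))%:C%C =
  (u^T *m (A *m adjoint A) *m map_mx Num.conj u) 0 0.
Proof.
by rewrite sqnormE map_mxM trmx_mul trmxK /adjoint map_trmx !mulmxA.
Qed.

Lemma sum_sqnorm_trmul (I : Type) (s : seq I) c (A : I -> 'M[R[i]]_c) (r : R)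
    (D : 'M[R[i]]_c) (u : 'cV[R[i]]_c) :
  \sum_(k <- s) A k *m adjoint (A k) = r%:C%C *: D ->
  D *m map_mx Num.conj u = map_mx Num.conj u ->
  \sum_(k <- s) sqnorm ((A k)^T *m u) = r * sqnorm u.
Proof.
move=> sA Du; apply: (@complexI R).
rewrite rmorphM /= sqnormE raddf_sum.
under eq_bigr do rewrite /= sqnorm_trmul.
rewrite -summxE -mulmx_suml -mulmx_sumr sA -scalemxAr -scalemxAl -mulmxA Du.
by rewrite mxE.
Qed.

End sqnorm_theory.

Section transfer.
Variables (R : realType) (G : zmodType).
Local Notation dual := (dualGroup R G).
Variables (alpha : {additive G -> G}) (lambda : probability dual R).
Hypothesis trans_inv : forall u,
  measure_preserving lambda (fun v : dual => (u * v)%g).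
Hypothesis endo_pres : measure_preserving lambda (@dual_endo R G alpha).
Variables (N : nat) (ks : seq dual).
Hypotheses (N_gt0 : (0 < N)%N) (ks_uniq : uniq ks) (ks_size : size ks = N).
Hypothesis ksP : forall k, k \in ks <-> dual_endo alpha k = 1%g.

(** [F'] is the transfer (Ruelle) operator applied to [F]: its value at a point
    is the mean of [F] over the fibre of the dual endomorphism.  A relation,
    read off upstairs, saves choosing a measurable section. *)
Definition transfers (F F' : dual -> R) := {ae lambda, forall w,
  \sum_(k <- ks) F (k * w)%g = N%:R * F' (dual_endo alpha w)}.

Lemma sum_fibre (V : nmodType) (F : dual -> V) (w : dual) :
  \sum_(z \in [set z | dual_endo alpha z = dual_endo alpha w]) F z =
  \sum_(k <- ks) F (k * w)%g.
Proof.
have inj : injective (fun k : dual => (k * w)%g) by exact: mulIg.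
rewrite -(big_map (fun k => (k * w)%g) xpredT F) [RHS]fsbig_seq ?map_inj_uniq //.
suff -> : [set z | dual_endo alpha z = dual_endo alpha w] =
  [set` [seq (k * w)%g | k <- ks]] by [].
apply/seteqP; split=> z /=.
  move=> zw; apply/mapP; exists (z * w^-1)%g; last by rewrite mulgVK.
  by apply/ksP; rewrite dual_endoM dual_endoV zw mulgV.
move=> /mapP[k /ksP k1 ->]; by rewrite dual_endoM k1 mul1g.
Qed.

Lemma integral_fibre_sum (F : dual -> R) : measurable_fun setT F ->
  (forall w, 0 <= F w) ->
  (\int[lambda]_w (\sum_(k <- ks) F (k * w)%g)%:E =
   N%:R%:E * \int[lambda]_w (F w)%:E)%E.
Proof.
move=> mF F0.
have mFk k : measurable_fun setT (fun w : dual => (F (k * w)%g)%:E).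
  apply/measurable_EFinP; apply: measurableT_comp => //.
  exact: (proj1 (trans_inv k)).
under eq_integral do rewrite -sumEFin.
rewrite ge0_integral_sum //; last by move=> k w _; rewrite lee_fin.
rewrite -ks_size; elim: ks => [|k s IH]; first by rewrite big_nil mul0e.
rewrite big_cons IH.
rewrite (@integral_measure_preserving _ _ _ _ _ (trans_inv k) (fun w => (F w)%:E)).
- by rewrite /= -natr1 addrC EFinD ge0_muleDl ?lee_fin // mul1e.
- exact/measurable_EFinP.
- by move=> w; rewrite lee_fin.
Qed.

Lemma integral_pull_endo (F : dual -> R) : measurable_fun setT F ->
  (forall w, 0 <= F w) ->
  (\int[lambda]_w (N%:R * F (dual_endo alpha w))%:E =
   N%:R%:E * \int[lambda]_w (F w)%:E)%E.
Proof.
move=> mF F0; have mE : measurable_fun setT (EFin \o F) by exact/measurable_EFinP.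
have E0 w : (0 <= (F w)%:E)%E by rewrite lee_fin.
under eq_integral do rewrite EFinM.
rewrite ge0_integralZl_EFin //.
  by rewrite (integral_measure_preserving endo_pres mE).
by apply: measurableT_comp mE _; exact: (proj1 endo_pres).
Qed.

Let N_cancel (x y : \bar R) : (N%:R%:E * x <= N%:R%:E * y)%E -> (x <= y)%E.
Proof. by rewrite lee_pmul2l // lte_fin ltr0n. Qed.

Let measurable_fibre_sum (F : dual -> R) : measurable_fun setT F ->
  measurable_fun setT (fun w : dual => \sum_(k <- ks) F (k * w)%g).
Proof.
move=> mF; apply: measurable_sum => k; apply: measurableT_comp => //.
exact: (proj1 (trans_inv k)).
Qed.

Let measurable_pull_endo (F : dual -> R) : measurable_fun setT F ->
  measurable_fun setT (fun w : dual => N%:R * F (dual_endo alpha w)).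
Proof.
move=> mF; apply: measurable_funM => //; apply: measurableT_comp => //.
exact: (proj1 endo_pres).
Qed.

Lemma transfers_integral (F F' : dual -> R) :
  measurable_fun setT F -> measurable_fun setT F' ->
  (forall w, 0 <= F w) -> (forall w, 0 <= F' w) -> transfers F F' ->
  (\int[lambda]_w (F' w)%:E = \int[lambda]_w (F w)%:E)%E.
Proof.
move=> mF mF' F0 F'0 tr.
have : (N%:R%:E * \int[lambda]_w (F' w)%:E = N%:R%:E * \int[lambda]_w (F w)%:E)%E.
  rewrite -integral_pull_endo // -integral_fibre_sum //.
  apply: ge0_ae_eq_integral => //.
  - by apply/measurable_EFinP; exact: measurable_pull_endo.
  - by apply/measurable_EFinP; exact: measurable_fibre_sum.
  - by move=> w _; rewrite lee_fin mulr_ge0.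
  - by move=> w _; rewrite lee_fin sumr_ge0.
  - by apply: filterS tr => w e _; rewrite e.
by move=> e; apply/le_anti/andP; split; apply: N_cancel; rewrite e.
Qed.

Lemma transfers_norm (F F' : dual -> R) :
  measurable_fun setT F -> measurable_fun setT F' -> transfers F F' ->
  (\int[lambda]_w `|F' w|%:E <= \int[lambda]_w `|F w|%:E)%E.
Proof.
move=> mF mF' tr; apply: N_cancel.
have mn (P : dual -> R) : measurable_fun setT P ->
    measurable_fun setT (fun w => `|P w|).
  by move=> mP; apply: measurableT_comp.
rewrite -(integral_pull_endo (mn _ mF')) // -(integral_fibre_sum (mn _ mF)) //.
apply: ae_ge0_le_integral => //.
- by apply/measurable_EFinP; exact: (measurable_pull_endo (mn _ mF')).
- by move=> w _; rewrite lee_fin sumr_ge0.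
- by apply/measurable_EFinP; exact: (measurable_fibre_sum (mn _ mF)).
apply: filterS tr => w e _; rewrite lee_fin.
have -> : N%:R * `|F' (dual_endo alpha w)| = `|N%:R * F' (dual_endo alpha w)|.
  by rewrite normrM ger0_norm.
by rewrite -e ler_norm_sum.
Qed.

Lemma transfersB (F F' P P' : dual -> R) : transfers F F' -> transfers P P' ->
  transfers (fun w => F w - P w) (fun w => F' w - P' w).
Proof.
by move=> tF tP; apply: filterS2 tF tP => w eF eP; rewrite sumrB eF eP mulrBr.
Qed.

Lemma transfersD (F F' P P' : dual -> R) : transfers F F' -> transfers P P' ->
  transfers (fun w => F w + P w) (fun w => F' w + P' w).
Proof.
by move=> tF tP; apply: filterS2 tF tP => w eF eP; rewrite big_split /= eF eP mulrDr.
Qed.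

Lemma transfers_cst (a : R) : transfers (fun=> a) (fun=> a).
Proof.
apply: aeW => w; rewrite big_const_seq iter_addr_0 count_predT ks_size.
by rewrite mulr_natl.
Qed.

Section filter.
Variables (c : nat) (m : dual -> 'I_c.+1) (H : dual -> 'M[R[i]]_c).
Hypothesis H_filter : is_filter alpha N m lambda H.

(** The filter equation says exactly that the transfer operator sends the
    density of [filter_op H f] to that of [f]. *)
Lemma filter_transfers (f : dual -> 'cV[R[i]]_c) :
  (forall i w, ~ sigma m i w -> f w i 0 = 0) ->
  transfers (fun w => sqnorm (filter_op alpha H f w)) (fun w => sqnorm (f w)).
Proof.
move=> f0; have [_ _ Hae] := H_filter.
have := ae_measure_preserving endo_pres Hae; apply: filterS => w.
rewrite sum_fibre => Hw.
rewrite -(@sum_sqnorm_trmul _ _ ks c (fun k => H (k * w)%g) N%:R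
  (Sigma m (dual_endo alpha w))).
- apply: eq_big_seq => k /ksP k1.
  by rewrite /filter_op dual_endoM k1 mul1g.
- by rewrite Hw rmorph_nat.
- rewrite /Sigma mul_diag_mx; apply/matrixP => i j; rewrite !mxE.
  have [s|ns] := pselect (sigma m i (dual_endo alpha w)).
    by rewrite indicE mem_set // mul1r.
  by rewrite (ord1 j) f0 // rmorph0 mulr0.
Qed.

End filter.
End transfer.

(** * Density of a function algebra in L1 *)

Section sharpening.
Variable R : realType.

(** Iterating [sharpen] on [-1, 1] produces polynomials that converge to the
    indicator of the positive numbers: on that interval [sharpen] increases its
    argument and keeps its sign, and its only fixed points are [0] and [1]. *)
Definition sharpen (y : R) := y + y ^+ 2 * (1 - y) / 2.

Lemma sharpen_step (y : R) : -1 <= y <= 1 ->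
  [/\ y <= sharpen y, sharpen y <= 1 & (y <= 0 -> sharpen y <= 0)].
Proof.
move=> /andP[y1 y2]; rewrite /sharpen; have y20 := sqr_ge0 y.
have ysq : y ^+ 2 <= 1 by rewrite expr2; nra.
split.
- by rewrite lerDl divr_ge0 // mulr_ge0 // subr_ge0.
- rewrite -subr_ge0.
  have -> : 1 - (y + y ^+ 2 * (1 - y) / 2) = (1 - y) * (1 - y ^+ 2 / 2) by field.
  by apply: mulr_ge0; lra.
- move=> y0; have -> : y + y ^+ 2 * (1 - y) / 2 = y * (1 + (y - y ^+ 2) / 2) by field.
  by rewrite mulr_le0_ge0 //; lra.
Qed.

Lemma sharpen_iter_bound n (y : R) : -1 <= y <= 1 ->
  -1 <= iter n sharpen y <= 1.
Proof.
move=> yb; elim: n => //= n /[dup] /andP[l _] /sharpen_step[h1 h2 _].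
by rewrite h2 andbT (le_trans l).
Qed.

Lemma sharpen_cvg (y : R) : -1 <= y <= 1 ->
  iter n sharpen y @[n --> \oo] --> ((0 < y)%R%:R : R).
Proof.
move=> yb; set u := fun n => iter n sharpen y.
have nd : nondecreasing_seq u.
  apply/nondecreasing_seqP => n.
  by have [] := sharpen_step (sharpen_iter_bound n yb).
have cu : cvgn u.
  apply: nondecreasing_is_cvgn => //; exists 1 => _ [n _ <-].
  by have /andP[] := sharpen_iter_bound n yb.
set l := limn u.
have lfix : l = sharpen l.
  have c1 : (fun n => u n.+1) @ \oo --> l by rewrite cvg_shiftS.
  have c2 : (fun n => u n.+1) @ \oo --> sharpen l.
    rewrite /sharpen /=; apply: cvgD => //; apply: cvgM; last exact: cvg_cst.
    apply: cvgM; first by rewrite expr2; apply: cvgM.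
    by apply: cvgB => //; exact: cvg_cst.
  exact: (cvg_unique _ c1 c2).
have l01 : l = 0 \/ l = 1.
  have /eqP : l ^+ 2 * (1 - l) = 0 by move: lfix; rewrite /sharpen; lra.
  by rewrite mulf_eq0 sqrf_eq0 subr_eq0 => /orP[/eqP|/eqP <-]; [left|right].
have [y0|y0] := ltP 0 y.
  have yl : y <= l by apply: (nondecreasing_cvgn_le nd cu 0%N).
  case: l01 => lE; last by rewrite -lE.
  by move: (lt_le_trans y0 yl); rewrite lE ltxx.
have un0 n : u n <= 0.
  elim: n => //= n IH.
  by have [_ _ /(_ IH)] := sharpen_step (sharpen_iter_bound n yb).
case: l01 => lE; first by rewrite mulr0n -lE.
have : l <= 0 by apply: limr_le => //; exact: nearW.
by rewrite lE ler10.
Qed.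

End sharpening.

Section function_algebra.
Import HBSimple.
Context d (T : measurableType d) (R : realType) (mu : probability T R).
Variable alg : set (T -> R).
Hypothesis alg_cst : forall r, alg (fun=> r).
Hypothesis alg_add : forall P Q, alg P -> alg Q -> alg (fun x => P x + Q x).
Hypothesis alg_mul : forall P Q, alg P -> alg Q -> alg (fun x => P x * Q x).
Hypothesis alg_meas : forall P, alg P -> measurable_fun setT P.
Hypothesis alg_bnd : forall P, alg P -> exists2 M : R, 0 < M & forall x, `|P x| <= M.
Implicit Types F P Q : T -> R.

Definition L1dist F P : \bar R := (\int[mu]_x `|F x - P x|%:E)%E.

Definition approximable F := forall e : R, 0 < e ->
  exists2 P, alg P & (L1dist F P < e%:E)%E.

Lemma measurable_normB F P : measurable_fun setT F -> measurable_fun setT P ->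
  measurable_fun setT (fun x => `|F x - P x|%:E).
Proof.
move=> mF mP; apply/measurable_EFinP; apply: measurableT_comp => //.
exact: measurable_funB.
Qed.

Lemma le_L1dist a b F P F1 P1 F2 P2 : 0 <= a -> 0 <= b ->
  measurable_fun setT F -> measurable_fun setT P ->
  measurable_fun setT F1 -> measurable_fun setT P1 ->
  measurable_fun setT F2 -> measurable_fun setT P2 ->
  (forall x, `|F x - P x| <= a * `|F1 x - P1 x| + b * `|F2 x - P2 x|) ->
  (L1dist F P <= a%:E * L1dist F1 P1 + b%:E * L1dist F2 P2)%E.
Proof.
move=> a0 b0 mF mP mF1 mP1 mF2 mP2 h.
have n0 (z : R) : (0 <= `|z|%:E)%E by rewrite lee_fin.
rewrite /L1dist -!ge0_integralZl_EFin //; try exact: measurable_normB.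
rewrite -ge0_integralD //; first last.
- by apply: measurable_funeM; exact: measurable_normB.
- by move=> x _; rewrite mule_ge0.
- by apply: measurable_funeM; exact: measurable_normB.
- by move=> x _; rewrite mule_ge0.
apply: ge0_le_integral => //.
- exact: measurable_normB.
- by apply: emeasurable_funD; apply: measurable_funeM; exact: measurable_normB.
- by move=> x _; rewrite -!EFinM -EFinD lee_fin.
Qed.

Lemma alg_approximable P : alg P -> approximable P.
Proof.
move=> aP e e0; exists P => //; rewrite /L1dist.
by under eq_integral do rewrite subrr normr0; rewrite integral0 lte_fin.
Qed.

Lemma approximableDM F Q r : measurable_fun setT F -> measurable_fun setT Q ->
  approximable F -> approximable Q -> approximable (fun x => F x + r * Q x).
Proof.
move=> mF mQ aF aQ e e0.
have r1 : 0 < `|r| + 1 by rewrite ltr_wpDl.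
have [P algP dP] := aF (e / 2) (divr_gt0 e0 (ltr0Sn R 1)).
have [S algS dS] := aQ (e / 2 / (`|r| + 1)) (divr_gt0 (divr_gt0 e0 (ltr0Sn R 1)) r1).
exists (fun x => P x + r * S x).
  by apply: alg_add => //; apply: (alg_mul (alg_cst r)).
apply: (le_lt_trans (@le_L1dist 1 (`|r| + 1) _ _ F P Q S ler01 (ltW r1) _ _
  mF (alg_meas algP) mQ (alg_meas algS) _)).
- by apply: measurable_funD => //; exact: measurable_funM.
- by apply/alg_meas/alg_add => //; apply: (alg_mul (alg_cst r)).
- move=> x; rewrite mul1r.
  have -> : F x + r * Q x - (P x + r * S x) = (F x - P x) + r * (Q x - S x) by ring.
  apply: le_trans (ler_normD _ _) _; rewrite lerD2l normrM ler_wpM2r //.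
  by rewrite lerDl.
rewrite mul1e.
have -> : e%:E = ((e / 2)%:E + (`|r| + 1)%:E * (e / 2 / (`|r| + 1))%:E)%E.
  by rewrite -EFinM -EFinD; congr EFin; field; rewrite gt_eqF.
by apply: lteD => //; rewrite lte_pmul2l // lte_fin.
Qed.

Lemma approximableM F Q M : measurable_fun setT F -> measurable_fun setT Q ->
  0 < M -> (forall x, `|F x| <= M) ->
  approximable F -> approximable Q -> approximable (fun x => F x * Q x).
Proof.
move=> mF mQ M0 FM aF aQ e e0.
have [S algS dS] := aQ (e / 2 / M) (divr_gt0 (divr_gt0 e0 (ltr0Sn R 1)) M0).
have [B B0 SB] := alg_bnd algS.
have [P algP dP] := aF (e / 2 / B) (divr_gt0 (divr_gt0 e0 (ltr0Sn R 1)) B0).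
exists (fun x => P x * S x); first exact: alg_mul.
apply: (le_lt_trans (@le_L1dist M B _ _ Q S F P (ltW M0) (ltW B0) _ _
  mQ (alg_meas algS) mF (alg_meas algP) _)).
- exact: measurable_funM.
- by apply/alg_meas/alg_mul.
- move=> x.
  have -> : F x * Q x - P x * S x = F x * (Q x - S x) + S x * (F x - P x) by ring.
  by apply: le_trans (ler_normD _ _) _; rewrite !normrM lerD // ler_wpM2r.
have -> : e%:E = (M%:E * (e / 2 / M)%:E + B%:E * (e / 2 / B)%:E)%E.
  by rewrite -!EFinM -EFinD; congr EFin; field; rewrite !gt_eqF.
by apply: lteD; rewrite lte_pmul2l // lte_fin.
Qed.

Lemma approximable_cvg (u : nat -> T -> R) F : measurable_fun setT F ->
  (forall n, measurable_fun setT (u n)) -> (forall n, approximable (u n)) ->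
  (fun n => L1dist F (u n)) @ \oo --> 0%E -> approximable F.
Proof.
move=> mF mu' au cu e e0.
have e20 : 0 < e / 2 by rewrite divr_gt0.
have [n _ /(_ n (leqnn n)) /= dn] : \forall n \near \oo, (L1dist F (u n) < (e / 2)%:E)%E.
  apply: (cu [set x | (x < (e / 2)%:E)%E]); exact: open_ereal_lt'.
have [P algP dP] := au n _ e20; exists P => //.
apply: (le_lt_trans (@le_L1dist 1 1 F P F (u n) (u n) P ler01 ler01
  mF (alg_meas algP) mF (mu' n) (mu' n) (alg_meas algP) _)).
  by move=> x; rewrite !mul1r; exact: ler_distD.
rewrite !mul1e; have -> : e%:E = ((e / 2)%:E + (e / 2)%:E)%E.
  by rewrite -EFinD -splitr.
exact: lteD.
Qed.

Lemma approximable_bounded_cvg (u : nat -> T -> R) F M : measurable_fun setT F ->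
  (forall n, measurable_fun setT (u n)) -> (forall n, approximable (u n)) ->
  (forall n x, `|u n x| <= M) -> (forall x, u n x @[n --> \oo] --> F x) ->
  approximable F.
Proof.
move=> mF mu' au uM cu; apply: (approximable_cvg mF mu' au).
have [|||||_ + _] := @dominated_convergence _ T R mu setT measurableT
  (fun n x => (u n x)%:E) (EFin \o F) (cst M%:E).
- by move=> n; exact/measurable_EFinP.
- exact/measurable_EFinP.
- by apply: aeW => x _; apply: cvg_EFin; [exact: nearW|exact: cu].
- exact: (finite_measure_integrable_cst mu).
- by apply: aeW => x n _; rewrite lee_fin.
apply: cvg_trans; apply: near_eq_cvg; apply: nearW => n /=.
by apply: eq_integral => x _ /=; rewrite distrC.
Qed.

Definition approximable_sets : set (set T) :=
  [set A | measurable A /\ approximable (\1_A)].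

Lemma approximable_sets_pos P : alg P -> approximable_sets [set x | 0 < P x].
Proof.
move=> algP; have [M M0 PM] := alg_bnd algP.
have mA : measurable [set x | 0 < P x].
  have := alg_meas algP measurableT (measurable_itv `]0, +oo[).
  congr (measurable _); apply/seteqP; split=> x /=; rewrite in_itv /= andbT.
    by case.
  by [].
split=> //.
pose u n x := iter n (@sharpen R) (M^-1 * P x).
have ub x : -1 <= M^-1 * P x <= 1.
  by rewrite -ler_norml normrM gtr0_norm ?invr_gt0 // mulrC ler_pdivrMr // mul1r.
have algu n : alg (u n).
  elim: n => [|n IH]; first exact: (alg_mul (alg_cst _)).
  rewrite /u /= /sharpen; apply: alg_add => //.
  apply: (alg_mul _ (alg_cst _)); apply: alg_mul.
    by under eq_fun do rewrite expr2; exact: alg_mul.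
  apply: alg_add => //; under eq_fun do rewrite -mulN1r.
  by apply: (alg_mul (alg_cst _)).
apply: (@approximable_bounded_cvg u _ 1).
- exact: measurable_indic.
- by move=> n; exact: alg_meas.
- by move=> n; exact: alg_approximable.
- by move=> n x; rewrite ler_norml; exact: sharpen_iter_bound.
move=> x; rewrite indicE.
have -> : (x \in [set x | 0 < P x]) = (0 < M^-1 * P x).
  by rewrite pmulr_rgt0 ?invr_gt0 //; apply/idP/idP; rewrite inE.
exact: sharpen_cvg.
Qed.

Lemma approximable_sets_sigma : sigma_algebra setT approximable_sets.
Proof.
have sC A : approximable_sets A -> approximable_sets (~` A).
  move=> [mA aA]; split; first exact: measurableC.
  have := @approximableDM (fun=> 1) (\1_A) (-1) (measurable_cst _)
    (measurable_indic mA) (alg_approximable (alg_cst 1)) aA.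
  congr approximable; apply/funext => x.
  by rewrite !indicE in_setC mulN1r; case: (x \in A); rewrite ?subrr ?subr0.
have s0 : approximable_sets set0.
  split=> //; have := alg_approximable (alg_cst 0); congr approximable.
  by apply/funext => x; rewrite indicE in_set0.
have sI A B : approximable_sets A -> approximable_sets B ->
    approximable_sets (A `&` B).
  move=> [mA aA] [mB aB]; split; first exact: measurableI.
  rewrite indicI; apply: (@approximableM _ _ 1) => //; try exact: measurable_indic.
  by move=> x; rewrite indicE normr_nat lern1; case: (x \in A).
have sU A B : approximable_sets A -> approximable_sets B ->
    approximable_sets (A `|` B).
  by move=> aA aB; rewrite -[_ `|` _]setCK setCU; apply/sC/sI; exact: sC.
split=> // [A aA|A aA]; first by rewrite setTD; exact: sC.
pose B n := \big[setU/set0]_(i < n) A i.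
have aB n : approximable_sets (B n).
  by rewrite /B; elim/big_ind : _ => // i _; exact: aA.
have mU : measurable (\bigcup_k A k).
  by apply: bigcup_measurable => n _; case: (aA n).
split=> //; apply: (@approximable_bounded_cvg (fun n => \1_(B n)) _ 1).
- exact: measurable_indic.
- by move=> n; apply: measurable_indic; case: (aB n).
- by move=> n; case: (aB n).
- by move=> n x; rewrite indicE normr_nat lern1; case: (x \in _).
move=> x; rewrite indicE; have [/set_mem[k _ Akx]|xnA] := boolP (x \in _).
  apply: cvg_near_cst; exists k.+1 => // n /= kn.
  rewrite indicE mem_set // /B -bigcup_mkord; by exists k.
apply: cvg_near_cst; apply: nearW => n /=; rewrite indicE memNset //.
rewrite /B -bigcup_mkord => -[k _ Akx]; move/negP: xnA; apply.
by apply/mem_set; exists k.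
Qed.

Hypothesis alg_gen : forall A, measurable A ->
  <<s [set A | exists2 P, alg P & A = [set x | 0 < P x]] >> A.

(** Stone-Weierstrass for L1: indicators of approximable sets make a sigma-algebra
    because [alg] is an algebra of bounded functions, and it contains the sets
    where a member of [alg] is positive thanks to [sharpen]. *)
Lemma alg_dense F : mu.-integrable setT (EFin \o F) -> approximable F.
Proof.
have ind A : measurable A -> approximable (\1_A : T -> R).
  move=> /alg_gen; suff : <<s [set A | exists2 P, alg P & A = [set x | 0 < P x]] >>
    `<=` approximable_sets by move=> /[apply] -[].
  apply: smallest_sub; first exact: approximable_sets_sigma.
  by move=> _ [P algP ->]; exact: approximable_sets_pos.
have sums n (a : 'I_n -> R) (A : 'I_n -> set T) : (forall i, measurable (A i)) ->
    approximable (fun x => \sum_(i < n) a i * \1_(A i) x).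
  elim: n a A => [|n IH] a A mA.
    under eq_fun do rewrite big_ord0.
    exact/alg_approximable/alg_cst.
  under eq_fun do rewrite big_ord_recr /=.
  apply: approximableDM; [|exact: measurable_indic|exact: IH|exact: ind].
  by apply: measurable_sum => i; apply: measurable_funM.
have sf (g : {sfun T >-> R}) : approximable g.
  by rewrite (funext (fimfunEord g)); apply: sums => i; exact: measurable_sfunP.
move=> iF; have [g [ig _ cg]] := approximation_sfun_integrable measurableT iF.
apply: (@approximable_cvg (fun n => g n)) => //.
  by apply/measurable_EFinP; exact: measurable_int iF.
Qed.

End function_algebra.

(** * Trigonometric polynomials and equidistribution *)

Section trigonometric.
Variables (R : realType) (G : zmodType) (G_countable : countable [set: G]).
Local Notation dual := (dualGroup R G).

Inductive trigpoly : set (dual -> R) :=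
| trig_mono a g : trigpoly (fun w => complex.Re (a * w g))
| trig_add P Q : trigpoly P -> trigpoly Q -> trigpoly (fun w => P w + Q w).

Lemma trig_cst r : trigpoly (fun=> r).
Proof.
have := trig_mono r%:C%C 0; congr trigpoly; apply/funext => w.
by rewrite dual0 mulr1.
Qed.

Lemma dualN (w : dual) g : w (- g) = ((w g)^*)%C.
Proof.
apply: (mulfI (dual_neq0 w g)).
by rewrite -dualD subrr dual0 -sqr_normc dual_norm1 expr1n.
Qed.

Lemma trig_mul P Q : trigpoly P -> trigpoly Q -> trigpoly (fun w => P w * Q w).
Proof.
elim=> [a g|P1 P2 _ IH1 _ IH2] tQ; last first.
  by under eq_fun do rewrite mulrDl; apply: trig_add; [exact: IH1|exact: IH2].
elim: tQ => [b h|Q1 Q2 _ IH1 _ IH2]; last first.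
  by under eq_fun do rewrite mulrDr; exact: trig_add.
have := trig_add (trig_mono ((2^-1)%:C%C * a * b) (g + h))
  (trig_mono ((2^-1)%:C%C * a * (b^*)%C) (g - h)).
congr trigpoly; apply/funext => w; rewrite !dualD dualN.
by case: a b (w g) (w h) => ? ? [? ?] [? ?] [? ?] /=; field.
Qed.

Lemma trig_measurable P : trigpoly P -> measurable_fun setT P.
Proof.
elim=> [a g|P1 P2 _ m1 _ m2]; first exact: measurable_Re_eval.
exact: measurable_funD.
Qed.

Lemma trig_bounded P : trigpoly P -> exists2 M : R, 0 < M &
  forall w, `|P w| <= M.
Proof.
elim=> [a g|P1 P2 _ [M1 M10 b1] _ [M2 M20 b2]]; last first.
  exists (M1 + M2); first exact: addr_gt0.
  by move=> w; apply: le_trans (ler_normD _ _) _; exact: lerD.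
exists (complex.Re `|a| + 1) => [|w].
  by rewrite ltr_wpDl //; have := normr_ge0 a; rewrite lecE /= => /andP[].
have := normc_ge_Re (a * w g); rewrite normrM dual_norm1 mulr1 lecE /=.
by move=> /andP[_ h]; apply: le_trans h _; rewrite lerDl.
Qed.

Lemma trig_dense (mu : probability dual R) (F : dual -> R) :
  mu.-integrable setT (EFin \o F) -> approximable mu trigpoly F.
Proof.
apply: alg_dense.
- exact: trig_cst.
- exact: trig_add.
- exact: trig_mul.
- exact: trig_measurable.
- exact: trig_bounded.
move=> A; rewrite [X in X A -> _](dual_measurableE R G_countable).
apply: sub_sigma_algebra2 => _ [a [g [t ->]]].
exists (fun w : dual => complex.Re (a * w g) + - t).
  by apply: trig_add; [exact: trig_mono|exact: trig_cst].
by apply/seteqP; split=> w; rewrite /halfplane /= subr_gt0.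
Qed.

End trigonometric.

Section equidistribution.
Variables (R : realType) (G : zmodType) (G_countable : countable [set: G]).
Local Notation dual := (dualGroup R G).
Variables (alpha : {additive G -> G}) (lambda : probability dual R).
Hypothesis trans_inv : forall u,
  measure_preserving lambda (fun v : dual => (u * v)%g).
Hypothesis endo_pres : measure_preserving lambda (@dual_endo R G alpha).
Variables (N : nat) (ks : seq dual).
Hypotheses (N_gt0 : (0 < N)%N) (ks_uniq : uniq ks) (ks_size : size ks = N).
Hypothesis ksP : forall k, k \in ks <-> dual_endo alpha k = 1%g.
Hypothesis ks_sep : forall g, ~ range alpha g ->
  exists2 k : dual, dual_endo alpha k = 1%g & k g != 1.
Hypothesis ker_dense : dense (\bigcup_(n in [set n | (1 <= n)%N])
     [set w : dual | iter n (dual_endo alpha) w = 1%g]).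
Local Notation transfers := (transfers alpha lambda N ks).

Lemma transfers_mono a g :
  transfers (fun w => complex.Re (a * w (alpha g))) (fun w => complex.Re (a * w g)).
Proof.
apply: aeW => w; transitivity (\sum_(k <- ks) complex.Re (a * w (alpha g))).
  apply: eq_big_seq => k /ksP /(congr1 (fun f : dual => f g)) /= ->.
  by rewrite mul1r.
by rewrite big_const_seq iter_addr_0 count_predT ks_size mulr_natl.
Qed.

(** The sum of [k g] over the kernel vanishes as soon as one term differs from [1]. *)
Lemma transfers_mono0 a g : ~ range alpha g ->
  transfers (fun w => complex.Re (a * w g)) (fun=> 0).
Proof.
move=> /ks_sep[k0 k01 k0g]; apply: aeW => w; rewrite mulr0.
have s0 : \sum_(k <- ks) k g = 0.
  have e : k0 g * (\sum_(k <- ks) k g) = \sum_(k <- ks) k g.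
    rewrite mulr_sumr -(big_map (fun k => k0 * k)%g xpredT (fun k : dual => k g)).
    have inj : injective (fun k : dual => (k0 * k)%g) by exact: mulgI.
    apply/perm_big/uniq_perm; rewrite ?map_inj_uniq // => k.
    apply/mapP/idP => [[k' /ksP k'1 ->]|/ksP k1].
      by apply/ksP; rewrite dual_endoM k01 k'1 mul1g.
    exists (k0^-1 * k)%g; last by rewrite mulVKg.
    by apply/ksP; rewrite dual_endoM dual_endoV k01 k1 invg1 mul1g.
  have : (k0 g - 1) * (\sum_(k <- ks) k g) = 0 by rewrite mulrBl e mul1r subrr.
  by move/eqP; rewrite mulf_eq0 subr_eq0 (negbTE k0g) => /eqP.
rewrite -(raddf_sum (@complex.Re R)) /=.
under eq_bigr do rewrite mulrCA.
by rewrite -mulr_suml s0 mul0r.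
Qed.

Lemma iter_range_eval n g (w : dual) : iter n (dual_endo alpha) w = 1%g ->
  range (iter n alpha) g -> w g = 1.
Proof.
move=> w1 [h _ <-]; have := congr1 (fun f : dual => f h) w1 => /= <-.
elim: n w h {w1} => //= n IH w h; rewrite -IH -iterSr //=.
Qed.

(** An element of every [alpha^n G] is killed by a dense set of characters, so
    the corresponding monomial is constant. *)
Lemma infinitely_divisible_trivial g : (forall n, range (iter n alpha) g) ->
  forall w : dual, w g = 1.
Proof.
move=> ag w; apply: contrapT => wg1.
have wh : halfplane (-1) g (-1) w.
  rewrite /halfplane /= mulN1r.
  have : `|w g| ^+ 2 = 1 by rewrite dual_norm1 expr1n.
  rewrite -add_Re2_Im2; move: wg1; case: (w g) => x y /= wg1 /(@complexI R) xy.
  rewrite ltrN2 ltNge; apply/negP => x1; apply: wg1.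
  have y20 := sqr_ge0 y.
  have xE : x = 1 by move: xy y20; rewrite !expr2; nra.
  have /eqP : y ^+ 2 = 0 by move: xy; rewrite xE expr1n; lra.
  by rewrite sqrf_eq0 xE => /eqP ->.
have [|v [vh [n _ vn]]] := ker_dense _ (halfplane_open (R := R) (-1) g (-1)).
  by exists w.
move: vh; rewrite /halfplane /= (iter_range_eval vn (ag n)).
by rewrite mulr1 /= ltxx.
Qed.

Definition stabilizes (P : dual -> R) := exists p : nat -> dual -> R,
  [/\ p 0%N = P, forall n, trigpoly (p n),
      forall n, transfers (p n) (p n.+1) &
      exists n0 r, forall n, (n0 <= n)%N -> p n = fun=> r].

Lemma stabilizes_cst r : stabilizes (fun=> r).
Proof.
exists (fun _ _ => r); split=> //; first by move=> _; exact: trig_cst.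
  by move=> _; exact: transfers_cst.
by exists 0%N, r.
Qed.

Lemma stabilizes_cons P Q : trigpoly P -> transfers P Q -> stabilizes Q ->
  stabilizes P.
Proof.
move=> tP PQ [q [q0 tq Tq [n0 [r qr]]]].
exists (fun n => if n is n'.+1 then q n' else P); split=> //.
- by case.
- by case=> [|n] //; rewrite q0.
- by exists n0.+1, r; case=> // n; rewrite ltnS; exact: qr.
Qed.

(** A transfer divides each frequency by [alpha] and removes the frequencies outside
    [range alpha]; a frequency that survives every transfer gives a constant
    monomial by [infinitely_divisible_trivial]. *)
Lemma trig_stabilizes P : trigpoly P -> stabilizes P.
Proof.
elim=> [a g|P1 P2 _ [p [p0 tp Tp [n0 [r pr]]]] _ [q [q0 tq Tq [n1 [s qs]]]]].
  have [|/existsNP[n]] := pselect (forall n, range (iter n alpha) g).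
    move=> /infinitely_divisible_trivial g1.
    have := stabilizes_cst (complex.Re a); congr stabilizes.
    by apply/funext => w; rewrite g1 mulr1.
  elim: n g => [|n IH] g ng; first by exfalso; apply: ng; exists g.
  have [[h _ hg]|ngr] := pselect (range alpha g).
    apply: (stabilizes_cons (trig_mono a g) (Q := fun w => complex.Re (a * w h))).
      by rewrite -hg; exact: transfers_mono.
    by apply: IH => -[k _ kh]; apply: ng; exists k => //=; rewrite kh.
  apply: (stabilizes_cons (trig_mono a g) (transfers_mono0 a ngr)).
  exact: stabilizes_cst.
exists (fun n w => p n w + q n w); split.
- by rewrite p0 q0.
- by move=> n; exact: trig_add.
- by move=> n; exact: transfersD.
- exists (maxn n0 n1), (r + s) => n; rewrite geq_max => /andP[h0 h1].
  by rewrite pr // qs.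
Qed.

(** Transfers contract the L1 norm, so it is enough to treat a trigonometric
    polynomial close to [F 0]; the limit must be the common integral. *)
Lemma transfers_equidistributed (F : nat -> dual -> R) (I : R) :
  (forall n, measurable_fun setT (F n)) -> (forall n w, 0 <= F n w) ->
  (forall n, (\int[lambda]_w (F n w)%:E = I%:E)%E) ->
  (forall n, transfers (F n) (F n.+1)) ->
  forall e, 0 < e -> exists n0, forall n, (n0 <= n)%N ->
    (L1dist lambda (F n) (fun=> I) < e%:E)%E.
Proof.
move=> mF F0 intF TF e e0.
have iF n : lambda.-integrable setT (EFin \o F n).
  apply/integrableP; split; first exact/measurable_EFinP.
  under eq_integral do rewrite /= ger0_norm //.
  by rewrite intF ltry.
have [P tP dP] := trig_dense G_countable (iF 0%N) (divr_gt0 e0 (ltr0Sn R 1)).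
have [p [p0 tp Tp [n0 [r pr]]]] := trig_stabilizes tP.
exists n0 => n nn.
have dn : (L1dist lambda (F n) (fun=> r) < (e / 2)%:E)%E.
  rewrite -(pr n nn); elim: n {nn} => [|n IH]; first by rewrite p0.
  apply: le_lt_trans IH; apply: (transfers_norm trans_inv endo_pres N_gt0 ks_size).
  - by apply: measurable_funB => //; exact: trig_measurable.
  - by apply: measurable_funB => //; exact: trig_measurable.
  - exact: transfersB.
have Ir : (`|I - r|%:E < (e / 2)%:E)%E.
  apply: le_lt_trans dn; rewrite -abse_EFin EFinB -(intF n).
  have -> : r%:E = (\int[lambda]_w r%:E)%E.
    by rewrite integral_cst // [X in (_ * X)%E]probability_setT mule1.
  rewrite -integralB_EFin //; last exact: (finite_measure_integrable_cst lambda).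
  apply: le_abse_integral => //; apply/measurable_EFinP.
  exact: measurable_funB.
apply: (le_lt_trans (@le_L1dist _ _ _ lambda 1 1 (F n) (fun=> I) (F n) (fun=> r)
  (fun=> I) (fun=> r) ler01 ler01 _ _ _ _ _ _ _)) => //.
  by move=> w; rewrite !mul1r (distrC I); exact: ler_distD.
rewrite !mul1e [e]splitr EFinD; apply: lteD => //.
by rewrite /L1dist integral_cst // [X in (_ * X)%E]probability_setT mule1.
Qed.

End equidistribution.

(** * Behaviour of a low-pass filter near the identity *)

Section low_pass_estimates.
Variable R : realType.
Implicit Types (z w : R[i]) (c : nat).

Definition sqmod z : R := complex.Re z ^+ 2 + complex.Im z ^+ 2.

Lemma sqmod_ge0 z : 0 <= sqmod z.
Proof. by rewrite addr_ge0 ?sqr_ge0. Qed.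

Lemma sqmodM z w : sqmod (z * w) = sqmod z * sqmod w.
Proof. by case: z w => ? ? [? ?]; rewrite /sqmod /=; ring. Qed.

Lemma sqmodC (r : R) : sqmod r%:C%C = r ^+ 2.
Proof. by rewrite /sqmod /= expr0n addr0. Qed.

Lemma sqmodD_le z w : sqmod (z + w) <= 2 * sqmod z + 2 * sqmod w.
Proof.
case: z w => x y [x' y']; rewrite /sqmod /= -subr_ge0.
have -> : 2 * (x ^+ 2 + y ^+ 2) + 2 * (x' ^+ 2 + y' ^+ 2) -
  ((x + x') ^+ 2 + (y + y') ^+ 2) = (x - x') ^+ 2 + (y - y') ^+ 2 by ring.
by rewrite addr_ge0 ?sqr_ge0.
Qed.

(** Young's inequality; losing one eighth of the main term is affordable because
    [7 / 8 * 2 > 1]. *)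
Lemma sqmodD_ge z w : 7 / 8 * sqmod z - 7 * sqmod w <= sqmod (z + w).
Proof.
case: z w => x y [x' y']; rewrite /sqmod /= -subr_ge0.
have -> : (x + x') ^+ 2 + (y + y') ^+ 2 -
   (7 / 8 * (x ^+ 2 + y ^+ 2) - 7 * (x' ^+ 2 + y' ^+ 2)) =
  ((x + 8 * x') ^+ 2 + (y + 8 * y') ^+ 2) / 8 by field.
by rewrite divr_ge0 // addr_ge0 ?sqr_ge0.
Qed.

Lemma sqmod_sum_le (s : seq R[i]) :
  sqmod (\sum_(z <- s) z) <= 2 ^+ size s * \sum_(z <- s) sqmod z.
Proof.
elim: s => [|z s IH].
  by rewrite !big_nil /sqmod /= expr0n addr0 mulr0.
rewrite !big_cons /= exprS; apply: le_trans (sqmodD_le _ _) _.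
have h : sqmod z <= 2 ^+ size s * sqmod z.
  by rewrite ler_peMl ?sqmod_ge0 // exprn_ege1 // ler1n.
lra.
Qed.

(** The constant is far from optimal; only its independence of [v] matters. *)
Lemma sqnorm_trmul_small c (E : 'M[R[i]]_c) (v : 'cV[R[i]]_c) (d : R) :
  (forall i j, sqmod (E i j) <= d) ->
  sqnorm (E^T *m v) <= (c * 2 ^ c)%N%:R * d * sqnorm v.
Proof.
move=> Ed; rewrite natrM natrX -!mulrA mulr_natl.
rewrite -[leLHS]/(\sum_(i < c) sqmod ((E^T *m v) i 0)).
rewrite -[X in _ *+ X]card_ord -sumr_const; apply: ler_sum => j _.
rewrite mxE -big_enum /= -(big_map (fun i => E^T j i * v i 0) xpredT id).
apply: le_trans (sqmod_sum_le _) _; rewrite size_map size_enum_ord.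
rewrite big_map ler_pM2l ?exprn_gt0 // mulr_sumr.
rewrite big_enum /=; apply: ler_sum => i _; rewrite sqmodM mxE.
by rewrite ler_wpM2r ?sqmod_ge0.
Qed.

Section two_steps.
Variables (c a N : nat) (A B : 'M[R[i]]_c) (u : 'cV[R[i]]_c) (d : R).
Hypothesis N_gt1 : (1 < N)%N.
Let D : 'M[R[i]]_c := (Num.sqrt N%:R)%:C%C *: pid_mx a.
Hypotheses (Ad : forall i j, sqmod (A i j - D i j) <= d)
           (Bd : forall i j, sqmod (B i j - D i j) <= d)
           (d_small : (c * 2 ^ c)%N%:R * d <= 1 / 56).
Let v := B^T *m u.

Let trmulE (M : 'M[R[i]]_c) (t : 'cV[R[i]]_c) j : (M^T *m t) j 0 =
  (if (j < a)%N then (Num.sqrt N%:R)%:C%C * t j 0 else 0) + ((M - D)^T *m t) j 0.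
Proof.
rewrite -{1}[M](subrK D) raddfD mulmxDl mxE addrC; congr (_ + _).
rewrite mxE (bigD1 j) //= big1 => [|i ij].
  rewrite !mxE eqxx /= addr0; case: ifP => ja; first by rewrite mulr1.
  by rewrite mulr0 mul0r.
by rewrite !mxE val_eqE (negbTE ij) /= mulr0 mul0r.
Qed.

(** Two consecutive steps near the identity: the second one makes the last
    [c - a] coordinates negligible, so that the first one multiplies the squared
    norm by almost [N], which is at least [2].  The constants are
    [13 / 8 = 7 / 8 * 2 - 7 / 56] and [1 / 32 = 7 / 8 * 2 / 56]. *)
Lemma low_pass_two_steps :
  13 / 8 * sqnorm v - sqnorm u / 32 <= sqnorm (A^T *m v).
Proof.
have small (M : 'M[R[i]]_c) t : (forall i j, sqmod (M i j - D i j) <= d) ->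
    sqnorm ((M - D)^T *m t) <= sqnorm t / 56.
  move=> Md; apply: (le_trans (@sqnorm_trmul_small _ _ _ d _)).
    by move=> i j; have := Md i j; rewrite !mxE.
  by rewrite [leRHS]mulrC; apply: ler_wpM2r; rewrite ?sqnorm_ge0 // -div1r.
have smallA := small A v Ad; have smallB := small B u Bd.
pose S1 := \sum_(j < c) (if (j < a)%N then sqmod (v j 0) else 0).
have vS : sqnorm v <= S1 + sqnorm ((B - D)^T *m u).
  rewrite /S1 /sqnorm -big_split /=; apply: ler_sum => j _.
  case: ifP => ja; first by rewrite lerDl sqmod_ge0.
  by rewrite /v trmulE ja !add0r.
have xS : 7 / 8 * (N%:R * S1) - 7 * sqnorm ((A - D)^T *m v) <= sqnorm (A^T *m v).
  rewrite /S1 /sqnorm !mulr_sumr -sumrB; apply: ler_sum => j _.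
  rewrite -![complex.Re _ ^+ 2 + _]/(sqmod _) (trmulE A v).
  case: ifP => ja; last first.
    rewrite !mulr0 !add0r; apply: le_trans (sqmod_ge0 _).
    by rewrite oppr_le0 mulr_ge0 ?sqmod_ge0.
  apply: le_trans (sqmodD_ge _ _); rewrite lerD2r sqmodM sqmodC sqr_sqrtr //.
have S10 : 0 <= S1 by apply: sumr_ge0 => j _; case: ifP; rewrite ?sqmod_ge0.
have NS : 2 * S1 <= N%:R * S1 by rewrite ler_wpM2r // ler_nat.
have v0 := sqnorm_ge0 v; lra.
Qed.

End two_steps.

Lemma near_sqmod (T : topologicalType) (t : T) c (H : T -> 'M[R[i]]_c) (d : R) :
  0 < d -> {for t, continuous H} ->
  \forall s \near t, forall i j, sqmod (H s i j - H t i j) <= d.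
Proof.
move=> d0 cH.
have e0 : 0 < (Num.sqrt d)%:C%C :> R[i] by rewrite ltcR sqrtr_gt0.
suff : nbhs t (H @^-1` [set M | forall i j, `|M i j - H t i j| < (Num.sqrt d)%:C%C]).
  apply: filterS => s /= h i j; have := h i j.
  rewrite -(ltr_pXn2r (n := 2)) ?nnegrE ?normr_ge0 ?(ltW e0) //.
  rewrite -add_Re2_Im2 -rmorphXn /= sqr_sqrtr ?(ltW d0) // ltcR; exact: ltW.
apply: cH; exists (fun i j => [set z | `|z - H t i j| < (Num.sqrt d)%:C%C]) => // i j.
exists (Num.sqrt d)%:C%C => // z /=; by rewrite distrC.
Qed.

End low_pass_estimates.

(** * Neighbourhoods of the identity have positive measure *)

Section open_positive.
Variables (R : realType) (G : zmodType) (alpha : {additive G -> G}).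
Local Notation dual := (dualGroup R G).
Variable lambda : probability dual R.
Hypothesis trans_inv : forall u,
  measure_preserving lambda (fun v : dual => (u * v)%g).
Variables (ks : seq dual).
Hypothesis ksP : forall k, k \in ks <-> dual_endo alpha k = 1%g.
Hypothesis endo_surj : forall u, exists w : dual, dual_endo alpha w = u.
Hypothesis ker_dense : dense (\bigcup_(n in [set n | (1 <= n)%N])
     [set w : dual | iter n (dual_endo alpha) w = 1%g]).

Lemma iter_kernel_finite n : exists s : seq dual, forall w,
  iter n (dual_endo alpha) w = 1%g -> w \in s.
Proof.
elim: n => [|n [s sP]]; first by exists [:: 1%g] => w /= ->; rewrite mem_head.
have /choice[lift liftP] := endo_surj.
exists [seq (k * lift u)%g | u <- s, k <- ks] => w; rewrite iterSr => /sP ws.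
apply/allpairsP; exists (dual_endo alpha w, w * (lift (dual_endo alpha w))^-1)%g.
split=> //=; last by rewrite mulgVK.
by apply/ksP; rewrite dual_endoM dual_endoV liftP mulgV.
Qed.

(** Countably many translates of a neighbourhood of the identity, those by the
    dense family of iterated kernels, cover the group. *)
Lemma open_measure_gt0 (V : set dual) : open V -> V 1%g -> (0 < lambda V)%E.
Proof.
move=> oV V1; rewrite lt0e measure_ge0 andbT; apply/eqP => V0.
have /choice[s sP] := iter_kernel_finite.
pose F n := [set v | exists2 d, d \in s n & V (d^-1 * v)%g].
have nF n : lambda.-negligible (F n).
  rewrite /F; elim: (s n) => [|d l IH].
    by rewrite (_ : [set _ | _] = set0); [exact: negligible_set0|
      apply/seteqP; split=> v // -[]].
  have nd : lambda.-negligible ((fun v => (d^-1 * v)%g) @^-1` V).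
    have [mt pt] := trans_inv (d^-1)%g; have mV := dual_open_measurable oV.
    exists ((fun v => (d^-1 * v)%g) @^-1` V); split=> //; last by rewrite pt.
    by rewrite -[X in measurable X]setTI; exact: mt.
  apply: negligibleS (negligibleU nd IH) => v [d'].
  by rewrite inE => /orP[/eqP -> Vv|dl Vv]; [left|right; exists d'].
have : lambda.-negligible (\bigcup_n F n) by exact: negligible_bigcup.
have -> : \bigcup_n F n = setT.
  apply/seteqP; split=> // w _.
  have oW : open ((fun v : dual => (v^-1 * w)%g) @^-1` V).
    have /continuousP : continuous (fun v : dual => (v^-1 * w)%g).
      move=> v; under eq_fun do rewrite dual_mulC.
      exact: (continuous_comp (@dual_inv_continuous R G v)
        (@dual_mul_continuous R G w _)).
    exact.
  have [|d [dV [n _ dn]]] := ker_dense _ oW.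
    by exists w; rewrite /= mulVg.
  by exists n => //; exists d => //; exact: sP.
move=> [A [mA A0 TA]]; have := probability_setT lambda.
have -> : setT = A by apply/seteqP; split.
by rewrite A0 => /eqP; rewrite eqe eq_sym oner_eq0.
Qed.

End open_positive.

(** * The filter operator *)

Section filter_operator.
Variables (R : realType) (G : zmodType) (G_countable : countable [set: G]).
Local Notation dual := (dualGroup R G).
Variables (alpha : {additive G -> G}) (lambda : probability dual R).
Hypothesis trans_inv : forall u,
  measure_preserving lambda (fun v : dual => (u * v)%g).
Hypothesis endo_pres : measure_preserving lambda (@dual_endo R G alpha).
Variables (N : nat) (ks : seq dual).
Hypotheses (N_gt0 : (0 < N)%N) (ks_uniq : uniq ks) (ks_size : size ks = N).
Hypothesis ksP : forall k, k \in ks <-> dual_endo alpha k = 1%g.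
Variables (c : nat) (m : dual -> 'I_c.+1) (H : dual -> 'M[R[i]]_c).
Hypothesis H_filter : is_filter alpha N m lambda H.
Local Notation L2f := (L2fun lambda (sigma m)).
Local Notation K := (L2sum lambda (sigma m)).

Lemma L2fun_measurable (f : L2f) : measurable_mx f.
Proof. by case: f => f /= fP; have := fP; rewrite inE => -[]. Qed.

Lemma L2fun_vanish (f : L2f) i w : ~ sigma m i w -> f w i 0 = 0.
Proof. by case: f => f /= fP; have := fP; rewrite inE => -[_ _ h]; exact: h. Qed.

Lemma L2fun_finite (f : L2f) : (\int[lambda]_w (sqnorm (f w))%:E < +oo)%E.
Proof. by case: f => f /= fP; have := fP; rewrite inE => -[]. Qed.

Lemma measurable_mx_trmul (A : dual -> 'M[R[i]]_c) (f : dual -> 'cV[R[i]]_c) :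
  measurable_mx A -> measurable_mx f -> measurable_mx (fun w => (A w)^T *m f w).
Proof.
move=> mA mf i j.
have E w : ((A w)^T *m f w) i j = \sum_(k < c) A w k i * f w k j.
  by rewrite mxE; apply: eq_bigr => k _; rewrite mxE.
split; under eq_fun do rewrite E raddf_sum /=; apply: measurable_sum => k;
  have [mAR mAI] := mA k i; have [mfR mfI] := mf k j.
- under eq_fun do rewrite Defs.ReM.
  by apply: measurable_funB; apply: measurable_funM.
- under eq_fun do rewrite Defs.ImM.
  by apply: measurable_funD; apply: measurable_funM.
Qed.

Lemma measurable_filter_op f : measurable_mx f ->
  measurable_mx (filter_op alpha H f).
Proof.
move=> mf; apply: measurable_mx_trmul; first by case: H_filter.
move=> i j; have [mR mI] := mf i j; have [me _] := endo_pres.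
by split; [exact: (measurableT_comp mR me)|exact: (measurableT_comp mI me)].
Qed.

Lemma filter_op_integral (f : L2f) :
  (\int[lambda]_w (sqnorm (filter_op alpha H f w))%:E =
   \int[lambda]_w (sqnorm (f w))%:E)%E.
Proof.
have mf := L2fun_measurable f; symmetry.
apply: (transfers_integral trans_inv endo_pres N_gt0 ks_size) => //.
- exact/measurable_sqnorm/measurable_filter_op.
- exact: measurable_sqnorm.
- by move=> w; exact: sqnorm_ge0.
- by move=> w; exact: sqnorm_ge0.
- apply: (filter_transfers endo_pres ks_uniq ksP H_filter) => i w.
  exact: L2fun_vanish.
Qed.

Lemma filter_op_L2 (f : L2f) :
  filter_op alpha H f \in L2fun_pred lambda (sigma m).
Proof.
rewrite inE; split.
- exact/measurable_filter_op/L2fun_measurable.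
- by rewrite filter_op_integral; exact: L2fun_finite.
- move=> i w nw; rewrite mxE big1 // => k _; rewrite mxE.
  by have [_ h _] := H_filter; rewrite h // mul0r.
Qed.

Definition filter_L2 (f : L2f) : L2f := L2Fun (filter_op_L2 f).

Definition filter_class (u : K) : K := L2class (filter_L2 (repr u)).

Lemma filter_classE (f : L2f) : filter_class (L2class f) = L2class (filter_L2 f).
Proof.
apply/L2classP; have /L2classP := L2class_repr (L2class f).
move=> /(ae_measure_preserving endo_pres); apply: filterS => w /= e.
by rewrite /filter_op e.
Qed.

Lemma filter_class_linear : linear filter_class.
Proof.
move=> a u v; rewrite -[u]L2class_repr -[v]L2class_repr.
rewrite -[a *: _]L2classZ -L2classD !filter_classE -[a *: _]L2classZ -L2classD.
apply/L2classP; apply: aeW => w.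
rewrite [LHS]/= /filter_op.
(* operations on representatives are pointwise by definition *)
change ((H w)^T *m (a *: repr u (dual_endo alpha w) + repr v (dual_endo alpha w)) =
  a *: ((H w)^T *m repr u (dual_endo alpha w)) +
  (H w)^T *m repr v (dual_endo alpha w)).
by rewrite mulmxDr scalemxAr.
Qed.

Lemma filter_class_norm u : L2norm (filter_class u) = L2norm u.
Proof.
rewrite -[u]L2class_repr filter_classE !L2normE; congr (Num.sqrt (fine _)).
exact: filter_op_integral.
Qed.

Lemma L2norm_eq0 (u : K) : L2norm u = 0 -> u = 0.
Proof.
rewrite -[u]L2class_repr; set f := repr u; rewrite L2normE => /eqP.
have If := L2fun_finite f; have mf := L2fun_measurable f.
have I0 : (0 <= \int[lambda]_w (sqnorm (f w))%:E)%E.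
  by apply: integral_ge0 => w _; rewrite lee_fin sqnorm_ge0.
rewrite sqrtr_eq0 => h.
have : (\int[lambda]_w (sqnorm (f w))%:E = 0)%E.
  apply/eqP; rewrite eq_le I0 andbT; move: h I0 If.
  by case: (\int[lambda]_w _)%E => [r||] //=; rewrite lee_fin.
have mS : measurable_fun setT (EFin \o (fun w => sqnorm (f w))).
  exact/measurable_EFinP/measurable_sqnorm.
under eq_integral do rewrite -[(sqnorm _)%:E]gee0_abs ?lee_fin ?sqnorm_ge0 //.
move=> /(ae_eq_integral_abs lambda measurableT mS)[A [mA A0 hA]].
rewrite -[0](_ : L2class (0 : L2f) = 0); last exact: pi_zeror.
apply/L2classP; exists A; split=> // w /= fw; apply: hA => /= e; apply: fw.
have {}e : sqnorm (f w) = 0 by have [] := e I.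
apply/matrixP => i j; rewrite (ord1 j) [RHS]mxE.
have h0 k : 0 <= sqmod (f w k 0) by exact: sqmod_ge0.
have /eqP := e; rewrite psumr_eq0 => [|k _]; last exact: h0.
move=> /allP /(_ i (mem_index_enum _)).
rewrite paddr_eq0 ?sqr_ge0 // !sqrf_eq0 => /andP[/eqP r0 /eqP i0].
by move: r0 i0; case: (f w i 0) => x y /= -> ->.
Qed.

Lemma L2norm0 : L2norm (0 : K) = 0.
Proof.
rewrite -[0](_ : L2class (0 : L2f) = 0); last exact: pi_zeror.
rewrite L2normE integral0_eq ?sqrtr0 // => w _; congr EFin.
by rewrite /sqnorm big1 // => i _; rewrite mxE /= expr0n addr0.
Qed.

Lemma filter_class0 : filter_class 0 = 0.
Proof.
by have := filter_class_linear (-1) 0 0; rewrite scaler0 addr0 scaleN1r addNr.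
Qed.

Lemma filter_class_inj : injective filter_class.
Proof.
move=> u v uv; have : filter_class ((-1) *: v + u) = 0.
  by rewrite filter_class_linear uv scaleN1r addNr.
move=> /(congr1 (@L2norm _ _ _ _ _ _)); rewrite filter_class_norm L2norm0.
by move=> /L2norm_eq0 /eqP; rewrite scaleN1r addrC subr_eq0 => /eqP.
Qed.

Lemma transfers_ae (F F' P : dual -> R) : {ae lambda, forall w, F w = F' w} ->
  transfers alpha lambda N ks F' P -> transfers alpha lambda N ks F P.
Proof.
move=> FF'.
have : {ae lambda, forall w, forall k, k \in ks -> F (k * w)%g = F' (k * w)%g}.
  elim: ks => [|k s IH]; first by apply: aeW.
  have := ae_measure_preserving (trans_inv k) FF'.
  apply: filterS2 IH => w h1 h2 k'; rewrite inE => /orP[/eqP -> //|]; exact: h1.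
apply: filterS2 => w e <-; apply: eq_big_seq => k kk; exact: e.
Qed.

Section pure.
Hypothesis endo_surj : forall u, exists w : dual, dual_endo alpha w = u.
Hypothesis ks_sep : forall g, ~ range alpha g ->
  exists2 k : dual, dual_endo alpha k = 1%g & k g != 1.
Hypothesis ker_dense : dense (\bigcup_(n in [set n | (1 <= n)%N])
     [set w : dual | iter n (dual_endo alpha) w = 1%g]).
Variable a : nat.
Hypotheses (N_gt1 : (1 < N)%N) (H_low : is_low_pass N a H).

Section backward_orbit.
Variables (f : nat -> L2f) (I : R).
Hypothesis f_orbit : forall n,
  {ae lambda, forall w, f n w = filter_op alpha H (f n.+1) w}.
Hypothesis f_integral : (\int[lambda]_w (sqnorm (f 0%N w))%:E = I%:E)%E.

Let F n w := sqnorm (f n w).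

Let mF n : measurable_fun setT (F n).
Proof. exact/measurable_sqnorm/L2fun_measurable. Qed.

Let F0 n w : 0 <= F n w. Proof. exact: sqnorm_ge0. Qed.

Let F_transfers n : transfers alpha lambda N ks (F n) (F n.+1).
Proof.
apply: (@transfers_ae _ (fun w => sqnorm (filter_op alpha H (f n.+1) w))).
  by apply: filterS (f_orbit n) => w e; rewrite /F e.
apply: (filter_transfers endo_pres ks_uniq ksP H_filter) => i w.
exact: L2fun_vanish.
Qed.

Let F_integral n : (\int[lambda]_w (F n w)%:E = I%:E)%E.
Proof.
elim: n => [|n <-]; first exact: f_integral.
exact: (transfers_integral trans_inv endo_pres N_gt0 ks_size).
Qed.

Let near_identity : exists V : set dual, [/\ open V, V 1%g &
  forall n, {ae lambda, forall w, V w ->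
    13 / 8 * F n.+1 (dual_endo alpha w)
      - F n.+2 (dual_endo alpha (dual_endo alpha w)) / 32 <= F n w}].
Proof.
have [Hc H1] := H_low.
pose C : R := (c * 2 ^ c)%N%:R; have C0 : 0 <= C by rewrite ler0n.
pose d : R := (56 * (C + 1))^-1.
have C1 : 0 < C + 1 by rewrite ltr_wpDl.
have d0 : 0 < d by rewrite invr_gt0 mulr_gt0.
have Cd : C * d <= 1 / 56.
  rewrite /d invfM mulrCA div1r ler_piMr // ler_pdivrMr // mul1r.
  by rewrite lerDl.
have : nbhs (1%g : dual) [set w | forall i j, sqmod (H w i j - H 1%g i j) <= d].
  exact: near_sqmod d0 (nbhs_singleton Hc).
rewrite nbhsE => -[U [oU U1] UH].
exists (U `&` (@dual_endo R G alpha) @^-1` U); split.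
- apply: openI => //; have /continuousP := @dual_endo_continuous R G alpha.
  exact.
- by split=> //=; rewrite dual_endo1.
move=> n; have := ae_measure_preserving endo_pres (f_orbit n.+1).
apply: filterS2 (f_orbit n) => w e0 e1 [/UH Uw /UH Uaw].
rewrite /F e0 {1}/filter_op {1 2}e1 {1 2}/filter_op.
apply: (@low_pass_two_steps _ _ a N _ _ _ d) => //; rewrite -H1.
  exact: Uw.
exact: Uaw.
Qed.

(** The squared norms along a backward orbit tend to the constant [I] in L1,
    whereas near the identity each is at least [13/8] of the next one, up to a
    small multiple of the one after. *)
Lemma backward_orbit_null : I = 0.
Proof.
have I0 : 0 <= I.
  by rewrite -lee_fin -(F_integral 0); apply: integral_ge0 => w _; rewrite lee_fin.
apply/eqP; rewrite eq_le I0 andbT leNgt; apply/negP => Ipos.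
have [V [oV V1 Vae]] := near_identity.
have mV := dual_open_measurable oV.
have Vpos := open_measure_gt0 trans_inv ksP endo_surj ker_dense oV V1.
have Vfin : lambda V \is a fin_num by exact: fin_num_measure.
have V0 : 0 < fine (lambda V) by rewrite fine_gt0 // Vpos ltey_eq Vfin.
(* three L1 distances, each entering the pointwise bound below with weight 4 *)
pose e := I * fine (lambda V) / 12.
have e0 : 0 < e by rewrite divr_gt0 // mulr_gt0.
have [n0 n0P] := transfers_equidistributed G_countable trans_inv endo_pres N_gt0
  ks_uniq ks_size ksP ks_sep ker_dense mF F0 F_integral F_transfers e0.
pose E n w := `|F n w - I|%:E.
have mE n : measurable_fun setT (E n).
  exact: measurable_normB (mF n) (measurable_cst _).
have E0 n w : (0 <= E n w)%E by rewrite lee_fin.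
have phi_meas := proj1 endo_pres.
pose E1 n := E n \o (@dual_endo R G alpha).
have mE1 n : measurable_fun setT (E1 n) by exact: measurableT_comp (mE n) phi_meas.
pose E2 n := E1 n \o (@dual_endo R G alpha).
have mE2 n : measurable_fun setT (E2 n) by exact: measurableT_comp (mE1 n) phi_meas.
have iE n : (n0 <= n)%N -> (\int[lambda]_w E n w < e%:E)%E by exact: n0P.
have iE1 n : (n0 <= n)%N -> (\int[lambda]_w E1 n w < e%:E)%E.
  by move=> /iE; rewrite (integral_measure_preserving endo_pres (mE n)).
have iE2 n : (n0 <= n)%N -> (\int[lambda]_w E2 n w < e%:E)%E.
  move=> /iE1; rewrite (integral_measure_preserving endo_pres (mE1 n)) //.
  by move=> w; exact: E0.
have mS : measurable_fun setT (fun w => E n0 w + E1 n0.+1 w + E2 n0.+2 w)%E.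
  by do 2!apply: emeasurable_funD => //.
have E10 n w : (0 <= E1 n w)%E by exact: E0.
have E20 n w : (0 <= E2 n w)%E by exact: E0.
have le : (\int[lambda]_w (I%:E * (\1_V w)%:E) <=
    \int[lambda]_w (4%:E * (E n0 w + E1 n0.+1 w + E2 n0.+2 w)))%E.
  apply: ae_ge0_le_integral => //.
  - by move=> w _; rewrite mule_ge0 ?lee_fin.
  - by apply: measurable_funeM; apply/measurable_EFinP; exact: measurable_indic.
  - by move=> w _; rewrite mule_ge0 ?adde_ge0 ?lee_fin // E0.
  - exact: measurable_funeM.
  apply: filterS (Vae n0) => w h _.
  rewrite /E2 /E1 /E /= -!EFinD -!EFinM lee_fin indicE.
  have [/set_mem/h|_] := boolP (w \in V); last by rewrite mulr0 mulr_ge0 ?addr_ge0.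
  rewrite mulr1.
  set x0 := F n0 _; set x1 := F n0.+1 _; set x2 := F n0.+2 _ => hx.
  have h0 := ler_norm (x0 - I); have h2 := ler_norm (x2 - I).
  have h1 : - (x1 - I) <= `|x1 - I| by rewrite -normrN ler_norm.
  have := normr_ge0 (x0 - I); have := normr_ge0 (x1 - I).
  have := normr_ge0 (x2 - I); lra.
move: le; rewrite ge0_integralZl_EFin //; last first.
  by apply/measurable_EFinP; exact: measurable_indic.
rewrite integral_indic // setIT ge0_integralZl_EFin //; last first.
  by move=> w _; do 2!apply: adde_ge0 => //.
rewrite ge0_integralD //; last 2 first.
  by move=> w _; apply: adde_ge0.
  exact: emeasurable_funD.
rewrite ge0_integralD // => le.
have : (I%:E * lambda V < 4%:E * (e%:E + e%:E + e%:E))%E.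
  apply: (le_lt_trans le); rewrite lte_pmul2l ?lte_fin //.
  by apply: lteD; [apply: lteD|]; [exact: iE|exact/iE1/leqW|exact/iE2/leqW/leqW].
rewrite -[lambda V]fineK // -!EFinD -!EFinM lte_fin.
by rewrite /e; lra.
Qed.

End backward_orbit.

(** By injectivity, the successive preimages of a vector in all the ranges form a
    backward orbit. *)
Lemma filter_class_pure :
  \bigcap_(n in [set: nat]) range (iter n filter_class) = [set 0].
Proof.
apply/seteqP; split=> [u uS|_ -> n _]; last first.
  by exists 0 => //; elim: n => //= n ->; exact: filter_class0.
have /choice[g gP] : forall n, exists g, iter n filter_class g = u.
  by move=> n; have [g _ gu] := uS n I; exists g.
have iter_inj n : injective (iter n filter_class).
  by elim: n => [//|n IH] x y /= /filter_class_inj /IH.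
have gS n : g n = filter_class (g n.+1).
  by apply: (iter_inj n); rewrite gP -(gP n.+1) iterSr.
pose f n := repr (g n).
have If := L2fun_finite (f 0%N).
have I0 : (0 <= \int[lambda]_w (sqnorm (f 0%N w))%:E)%E.
  by apply: integral_ge0 => w _; rewrite lee_fin sqnorm_ge0.
have fine0 : fine (\int[lambda]_w (sqnorm (f 0%N w))%:E) = 0.
  apply: (@backward_orbit_null f).
    by move=> n; apply/(L2classP (f n) (filter_L2 (f n.+1))); rewrite L2class_repr gS.
  by rewrite fineK // ge0_fin_numE.
apply: L2norm_eq0; rewrite -(gP 0%N) /= -[g 0%N]L2class_repr L2normE fine0.
exact: sqrtr0.
Qed.

End pure.
End filter_operator.

Theorem theorem8 (R : realType) (G : zmodType) (G_countable : countable [set: G])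
  (alpha : {additive G -> G}) (alpha_inj : injective alpha)
  (N : nat) (alpha_index : (image_cosets alpha #= `I_N)%card)
  (ker_dense : dense (\bigcup_(n in [set n | (1 <= n)%N])
     [set w : dualGroup R G | iter n (dual_endo alpha) w = 1%g]))
  (lambda : probability (dualGroup R G) R)
  (lambda_haar : translation_invariant lambda)
  (c : nat) (m : dualGroup R G -> 'I_c.+1)
  (m_borel : measurable_fun [set: dualGroup R G] (fun w => m w : nat))
  (H : dualGroup R G -> 'M[R[i]]_c) (H_filter : is_filter alpha N m lambda H) :
  exists S : L2sum lambda (sigma m) -> L2sum lambda (sigma m),
    [/\ acts_as S (filter_op alpha H),
        is_isometry S &
        (1 < N)%N -> forall a, (1 <= a <= c)%N -> is_low_pass N a H ->
          is_pure_isometry S].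
Proof.
have N_gt0 := index_gt0 R alpha_index.
have endo_surj := dual_endo_surj alpha_inj alpha_index N_gt0 (R := R).
have ks_sep := ker_separates R alpha_inj alpha_index.
have [ks [ks_uniq ks_size ksP]] := dual_endo_ker R alpha_inj alpha_index.
have trans_inv := translation_preserving G_countable lambda_haar.
have endo_pres := dual_endo_preserving G_countable lambda_haar endo_surj.
pose S := filter_class trans_inv endo_pres N_gt0 ks_uniq ks_size ksP H_filter.
have isoS : is_isometry S.
  by split; [exact: filter_class_linear|exact: filter_class_norm].
exists S; split=> //.
  move=> f; exists (filter_L2 trans_inv endo_pres N_gt0 ks_uniq ks_size ksP
    H_filter f) => //.
  exact: filter_classE.
move=> N_gt1 a _ H_low; split=> //.
exact: (filter_class_pure G_countable _ _ _ _ _ _ _ endo_surj ks_sep ker_dense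
  N_gt1 H_low).
Qed.
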